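(* Let $\lambda\in[0,1]$ and let $\nu$ be the rectangular Gaussian distribution with ratio $\lambda$, i.e. the image of the Gaussian distribution with mean zero and variance one by the rectangular Bercovici–Pata bijection with ratio $\lambda$. Then the free cumulants with ratio $\lambda$ of $\nu$ are given by $c_{2n}(\nu)=\delta_{n,1}$ for all $n\geq1$. When $\lambda=0$, $\nu=(\delta_1+\delta_{-1})/2$. When $\lambda>0$, $\nu$ has density $$x\mapsto\frac{\left[4\lambda-(x^2-1-\lambda)^2\right]^{1/2}}{2\pi\lambda|x|}\,\chi(x^2),$$ where $\chi$ is the characteristic function of the interval $[(1-\lambda^{1/2})^2,(1+\lambda^{1/2})^2]$. The support of $\nu$ is $[-1-\lambda^{1/2},-1+\lambda^{1/2}]\cup[1-\lambda^{1/2},1+\lambda^{1/2}]$.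
   Context: Free cumulants with ratio $\lambda$: for a symmetric probability measure $\mu$ with moments $m_n(\mu)$ of all orders, the sequence $(c_{2n}(\mu))_{n\ge1}$ is the one determined by $m_{2n}(\mu)=\sum_{\pi\in NC'(2n)}\lambda^{e(\pi)}\prod_{V\in\pi}c_{|V|}(\mu)$ for all $n\ge1$, where $NC'(2n)$ is the set of noncrossing partitions of $\{1,\dots,2n\}$ all of whose blocks have even cardinality and $e(\pi)$ is the number of blocks of $\pi$ with even minimum (with $0^0=1$). A symmetric probability measure $\mu$ on $\mathbb{R}$ is $*$-infinitely divisible (for classical convolution $*$) iff there is a (unique) symmetric positive finite measure $G$, called its Lévy measure, with $\int e^{it\xi}d\mu(t)=\exp\left(\int_{\mathbb{R}}(\cos(t\xi)-1)\frac{1+t^2}{t^2}\,dG(t)\right)$ for all $\xi\in\mathbb{R}$ (the integrand being $-\xi^2/2$ at $t=0$). The standard Gaussian has Lévy measure $\delta_0$. Rectangular $R$-transform with ratio $\lambda\in[0,1]$. Let $z\mapsto\sqrt z$ be the analytic square root on $\mathbb{C}\setminus[0,+\infty)$ with $\sqrt{-1}=i$, and $z\mapsto z^{1/2}$ the analytic square root on $\mathbb{C}\setminus(-\infty,0]$ with $1^{1/2}=1$; $\arg$ takes values in $[0,2\pi)$. For $\alpha\in(0,\pi)$, $\beta>0$ let $\Delta_{\alpha,\beta}=\{z: |\arg z-\pi|<\alpha,\ 0<|z|<\beta\}$. For a symmetric probability measure $\mu$ let $G_\mu(z)=\int\frac{d\mu(t)}{z-t}$ and, for $z\in\mathbb{C}\setminus[0,+\infty)$,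 $H_\mu(z)=\lambda\, G_\mu(1/\sqrt z)^2+(1-\lambda)\sqrt z\,G_\mu(1/\sqrt z)$. There is a (unique germ of) analytic function $H_\mu^{-1}$, defined for every $\alpha\in(0,\pi)$ on $\Delta_{\alpha,\beta}$ for some $\beta>0$, with $H_\mu^{-1}(z)/z\to1$ as $z\to0$ in $\{|\arg z-\pi|<\alpha\}$ and $H_\mu\circ H_\mu^{-1}=H_\mu^{-1}\circ H_\mu=\mathrm{id}$ on such a $\Delta_{\alpha,\beta}$. Near $0$ let $U(z)=\frac{-\lambda-1+[(\lambda+1)^2+4\lambda z]^{1/2}}{2\lambda}$ ($U(z)=z$ if $\lambda=0$). Then $C_\mu(z)=U\!\left(\frac{z}{H_\mu^{-1}(z)}-1\right)$. The map $\mu\mapsto C_\mu$ is injective. The rectangular free convolution $\mu\boxplus_\lambda\nu$ of symmetric probability measures is the unique symmetric probability measure with $C_{\mu\boxplus_\lambda\nu}=C_\mu+C_\nu$. A symmetric probability measure is $\boxplus_\lambda$-infinitely divisible if for each $n\ge1$ it is the $n$-fold $\boxplus_\lambda$-power of some symmetric probability measure. The formula $C_\mu(z)=z\int_{\mathbb{R}}\frac{1+t^2}{1-zt^2}\,dG(t)$ gives a bijection between $\boxplus_\lambda$-infinitely divisible distributions $\mu$ and symmetric positive finite measures $G$ (the Lévy measure of $\mu$). The rectangular Bercovici–Pata bijection $\Lambda_\lambda$ maps a symmetric $*$-infinitely divisible distribution to the $\boxplus_\lambda$-infinitely divisible distribution with the same Lévy measure; in particular $\nu$ is characterized by $C_\nu(z)=z$.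 *)

(* Defs.v *)
(* MathComp-Analysis, with the complex numbers R[i] of mathcomp-real-closed. *)
From HB Require Import structures.
From mathcomp Require Import all_boot all_order all_algebra.
From mathcomp Require Import complex.
From mathcomp Require Import all_classical all_reals all_analysis.

Set Implicit Arguments.
Unset Strict Implicit.
Unset Printing Implicit Defensive.
Import Order.TTheory GRing.Theory Num.Theory.
Import numFieldNormedType.Exports.

Local Open Scope classical_set_scope.
Local Open Scope ring_scope.
Local Open Scope complex_scope.

Notation prob R := (probability (measurableTypeR R) R).
Notation finmeas R := {finite_measure set (measurableTypeR R) -> \bar R}.

Definition symmetric_measure {R : realType}
    (mu : set (measurableTypeR R) -> \bar R) : Prop :=
  forall A : set (measurableTypeR R), measurable A -> mu [set - x | x in A] = mu A.

(** The topological support: the points all of whose open neighbourhoods have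
    positive mass. *)
Definition msupport {R : realType} (mu : set (measurableTypeR R) -> \bar R) :
    set R :=
  [set x : R | forall U : set R, open U -> U x -> (0 < mu U)%E].

Definition has_density {R : realType} (mu : set (measurableTypeR R) -> \bar R)
    (f : R -> R) : Prop :=
  forall A : set (measurableTypeR R), measurable A ->
    mu A = (\int[lebesgue_measure]_(x in A) (f x)%:E)%E.

Definition cintegral {R : realType}
    (mu : {measure set (measurableTypeR R) -> \bar R}) (f : R -> R[i]) : R[i] :=
  (\int[mu]_t complex.Re (f t)) +i* (\int[mu]_t complex.Im (f t)).

(** ** Free cumulants with ratio lambda *)

Definition moment {R : realType} (mu : prob R) (n : nat) : R :=
  \int[mu]_x (x ^+ n).

Definition noncrossing (m : nat) (P : {set {set 'I_m}}) : bool :=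
  [forall V in P, forall W in P, (V != W) ==>
    [forall a in V, forall b in W, forall c in V, forall d in W,
      ~~ [&& a < b, b < c & c < d]%N]].

(** NC'(m). The element i of {1, ..., m} is encoded by the ordinal i - 1. *)
Definition NCeven (m : nat) : {set {set {set 'I_m}}} :=
  [set P : {set {set 'I_m}} | [&& finset.partition P [set: 'I_m], noncrossing P
                                & [forall V in P, ~~ odd #|V|]]]%SET.

(** The minimum of V is i.+1 once V is read as a subset of {1, ..., m}. *)
Definition even_min (m : nat) (V : {set 'I_m}) : bool :=
  [exists i in V, [forall j in V, (i <= j)%N] && ~~ odd i.+1].

Definition nb_even_min (m : nat) (P : {set {set 'I_m}}) : nat :=
  #|[set V in P | even_min V]%SET|.

(** [c k] is the cumulant of order k; only the even orders matter. *)
Definition is_free_cumulants {R : realType} (lam : R) (mu : prob R)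
    (c : nat -> R) : Prop :=
  (forall n, mu.-integrable setT (fun x : measurableTypeR R => (x ^+ n)%:E)) /\
  (forall n, (0 < n)%N ->
    moment mu n.*2 =
      \sum_(P in NCeven n.*2) lam ^+ nb_even_min P * \prod_(V in P) c #|V|).

(** ** Infinite divisibility for a (relational) convolution *)

(** [conv_power conv sigma n mu]: mu is the (n + 1)-fold power of sigma. *)
Fixpoint conv_power {R : realType} (conv : prob R -> prob R -> prob R -> Prop)
    (sigma : prob R) (n : nat) (mu : prob R) : Prop :=
  match n with
  | 0 => forall A : set (measurableTypeR R), measurable A -> mu A = sigma A
  | n'.+1 => exists2 tau : prob R, conv_power conv sigma n' tau & conv tau sigma mu
  end.

Definition infdiv {R : realType} (conv : prob R -> prob R -> prob R -> Prop)
    (mu : prob R) : Prop :=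
  forall n, exists sigma : prob R, conv_power conv sigma n mu.

(** ** Classical convolution and classical Lévy measure *)

Definition is_conv {R : realType} (mu1 mu2 mu : prob R) : Prop :=
  forall A : set (measurableTypeR R), measurable A ->
    mu A = (mu1 \x mu2)%E [set p | A (p.1 + p.2)].

Definition levy_kernel {R : realType} (xi t : R) : R :=
  if t == 0 then - (xi ^+ 2 / 2)
  else (cos (t * xi) - 1) * ((1 + t ^+ 2) / t ^+ 2).

Definition is_levy {R : realType} (mu : prob R) (G : finmeas R) : Prop :=
  symmetric_measure G /\
  forall xi : R,
    cintegral mu (fun t => cos (t * xi) +i* sin (t * xi)) =
    (expR (\int[G]_t levy_kernel xi t))%:C.

(** ** Rectangular R-transform with ratio lambda *)

(** The analytic square root on C \ [0, +oo) with value i at -1; [sqrtc] is the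
    square root with nonnegative real part, i.e. the one on C \ (-oo, 0]. *)
Definition sqrt_up {R : realType} (z : R[i]) : R[i] :=
  (0 +i* 1) * sqrtc (- z).

(** Argument in [0, 2 pi). *)
Definition carg {R : realType} (z : R[i]) : R :=
  let a := acos (complex.Re z / complex.Re `|z|) in
  if 0 <= complex.Im z then a else 2 * pi - a.

Definition sector {R : realType} (alpha : R) : set R[i] :=
  [set z | z != 0 /\ `|carg z - pi| < alpha].

Definition Delta {R : realType} (alpha beta : R) : set R[i] :=
  [set z | sector alpha z /\ `|z| < beta%:C].

(** The property P holds on the domain of a germ: for every alpha in (0, pi),
    on Delta_{alpha, beta} for some beta > 0. *)
Definition germ_on {R : realType} (P : R[i] -> Prop) : Prop :=
  forall alpha : R, 0 < alpha -> alpha < pi ->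
    exists2 beta : R, 0 < beta & forall z, Delta alpha beta z -> P z.

Definition cauchy_transform {R : realType} (mu : prob R) (z : R[i]) : R[i] :=
  cintegral mu (fun t => (z - t%:C)^-1).

Definition Hfun {R : realType} (lam : R) (mu : prob R) (z : R[i]) : R[i] :=
  let s := sqrt_up z in
  let g := cauchy_transform mu s^-1 in
  lam%:C * g ^+ 2 + (1 - lam)%:C * (s * g).

(** h represents the germ H_mu^-1.  In the order of R[i], [0 <= w] means that w
    is real and nonnegative, so [~~ (0 <= h z)] says that h z lies in the domain
    of H_mu. *)
Definition is_Hinv {R : realType} (lam : R) (mu : prob R) (h : R[i] -> R[i]) :
    Prop :=
  [/\ germ_on (fun z => derivable (h : R[i]^o -> R[i]^o) z 1),
      forall alpha : R, 0 < alpha -> alpha < pi ->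
        ((h z / z : R[i]^o)
           @[z --> within (sector alpha) (nbhs (0 : R[i]^o))]) --> (1 : R[i]^o)
    & germ_on (fun z =>
        [/\ ~~ (0 <= h z), Hfun lam mu (h z) = z & h (Hfun lam mu z) = z])].

Definition Ufun {R : realType} (lam : R) (z : R[i]) : R[i] :=
  if lam == 0 then z
  else (- lam%:C - 1 + sqrtc ((lam%:C + 1) ^+ 2 + 4 * lam%:C * z)) / (2 * lam%:C).

(** C represents the germ C_mu. *)
Definition is_Rtransform {R : realType} (lam : R) (mu : prob R)
    (C : R[i] -> R[i]) : Prop :=
  exists2 h : R[i] -> R[i], is_Hinv lam mu h
    & germ_on (fun z => C z = Ufun lam (z / h z - 1)).

Definition is_rect_conv {R : realType} (lam : R) (mu1 mu2 mu : prob R) : Prop :=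
  [/\ symmetric_measure mu1, symmetric_measure mu2, symmetric_measure mu
    & exists C1 C2 : R[i] -> R[i],
        [/\ is_Rtransform lam mu1 C1, is_Rtransform lam mu2 C2
          & is_Rtransform lam mu (fun z => C1 z + C2 z)]].

Definition is_rect_levy {R : realType} (lam : R) (mu : prob R) (G : finmeas R) :
    Prop :=
  symmetric_measure G /\
  is_Rtransform lam mu (fun z =>
    z * cintegral G (fun t => (1 + t ^+ 2)%:C / (1 - z * (t ^+ 2)%:C))).

(** nu is the image of mu by the rectangular Bercovici-Pata bijection. *)
Definition is_BP_image {R : realType} (lam : R) (mu nu : prob R) : Prop :=
  [/\ symmetric_measure mu /\ infdiv is_conv mu,
      symmetric_measure nu /\ infdiv (is_rect_conv lam) nu
    & exists2 G : finmeas R, is_levy mu G & is_rect_levy lam nu G].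

Definition is_rect_gaussian {R : realType} (lam : R) (nu : prob R) : Prop :=
  is_BP_image lam (normal_prob 0 1) nu.

(* Main.v *)
(* The Levy measure of the standard Gaussian is the Dirac mass at 0, so C_nu(z) = z.
   Evaluating the definition of the R-transform at z = -r shows that
   F(u) = int 1 / (1 + u t^2) dnu(t) equals 1 - r at u = r / ((1 - r) (1 - lam r)),
   that is, u (lam F^2 + (1 - lam) F) = 1 - F along a sequence u -> 0+.  Expanding
   this equation at u = 0 shows that all even moments m_n of nu are finite and that
   m_(n+1) = (1 - lam) m_n + lam sum_k m_k m_(n-k).  The same recursion holds for
   the sums of lam^(number of blocks with even minimum) over noncrossing pair
   partitions (split at the block of the least element), which gives the cumulants.
   The explicit candidate measure satisfies the same equation, by a direct
   integration, hence has the same moments; as it is compactly supported and nu is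
   symmetric, the two measures agree. *)
Require Import Defs.
From HB Require Import structures.
From mathcomp Require Import all_boot all_order all_algebra.
From mathcomp Require Import complex.
From mathcomp Require Import all_classical all_reals all_analysis.
From mathcomp Require Import measurable_realfun.
From mathcomp Require Import ring lra zify.
Set Implicit Arguments.
Unset Strict Implicit.
Unset Printing Implicit Defensive.
Import Order.TTheory GRing.Theory Num.Theory.
Import numFieldNormedType.Exports.

Local Open Scope classical_set_scope.
Local Open Scope ring_scope.

(** * Noncrossing pair partitions of an interval *)

Section NoncrossingPairPartitions.
Context {R : comNzRingType} {m : nat}.
Implicit Types (P Q : {set {set 'I_m}}) (V W : {set 'I_m}) (i k x : 'I_m).
Local Open Scope set_scope.

(** The negative axis is the bisector of every sector, so it can be used whatever the size of the
    germ, and there everything becomes real: the square root is imaginary and, by symmetry, so is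
    the Cauchy transform. The resulting equation has [1 - r] as its only nonnegative root. The
    obstacle is that no moment of [nu] is known to exist at the start and that the equation is
    available only near 0. The expansion is therefore run on the integrals of x^(2n) / (1 + u x^2):
    the equation expresses the one of order n + 1 through quantities of order at most n, so it
    converges as u tends to 0, and Fatou's lemma turns this convergence into the finiteness of the
    next moment. The explicit measure is compared with [nu] through the quadratic equation alone, so
    no germ has to be inverted for it. Compactness of the support passes to [nu] through the growth
    of its moments, after which polynomials determine the measure. *)

Definition ord_itv (a b : nat) : {set 'I_m} := [set x : 'I_m | (a <= x < b)%N].

(** All intervals live in one ['I_m], so the two pieces of a split partition need no relabelling and
    the parity of a minimum keeps its absolute meaning. *)
Definition NCpair (a b : nat) : {set {set {set 'I_m}}} :=
  [set P | [&& finset.partition P (ord_itv a b), noncrossing P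
             & [forall V in P, #|V| == 2]]].

Definition NCpair_weight (w : {set 'I_m} -> R) (a b : nat) : R :=
  (\sum_(P in NCpair a b) \prod_(V in P) w V)%R.

Lemma noncrossingP P : reflect (forall V W x y z t, V \in P -> W \in P ->
    V != W -> x \in V -> y \in W -> z \in V -> t \in W ->
    (x < y)%N -> (y < z)%N -> (z < t)%N -> False) (noncrossing P).
Proof.
apply: (iffP idP) => [+ V W x y z t VP WP VW xV yW zV tW xy yz zt|H].
  move=> /'forall_implyP/(_ V VP)/'forall_implyP/(_ W WP)/implyP/(_ VW).
  move=> /'forall_implyP/(_ x xV)/'forall_implyP/(_ y yW).
  move=> /'forall_implyP/(_ z zV)/'forall_implyP/(_ t tW).
  by rewrite xy yz zt.
apply/'forall_implyP => V VP; apply/'forall_implyP => W WP; apply/implyP => VW.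
apply/'forall_implyP => x xV; apply/'forall_implyP => y yW.
apply/'forall_implyP => z zV; apply/'forall_implyP => t tW.
by apply/negP => /and3P[xy yz zt]; exact: (H V W x y z t).
Qed.

Lemma NCpairP a b P : reflect
  [/\ forall V, V \in P -> V \subset ord_itv a b /\ #|V| = 2,
      forall x, x \in ord_itv a b -> exists2 V, V \in P & x \in V,
      forall V W x, V \in P -> W \in P -> x \in V -> x \in W -> V = W
    & noncrossing P] (P \in NCpair a b).
Proof.
apply: (iffP idP) => [|[Hs Hc Ht Hn]].
  rewrite inE => /and3P[/and3P[/eqP Pc /finset.trivIsetP Pt _] Pn /'forall_implyP P2].
  split=> //.
  - move=> V VP; split; last exact/eqP/P2.
    by rewrite -Pc; exact: finset.bigcup_sup.
  - by move=> x; rewrite -Pc => /finset.bigcupP[V VP xV]; exists V.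
  - move=> V W x VP WP xV xW; apply/eqP/negPn/negP => /(Pt _ _ VP WP).
    by rewrite -finset.setI_eq0 => /eqP/setP/(_ x); rewrite !inE xV xW.
rewrite inE Hn; apply/and3P; split=> //; last first.
  by apply/'forall_implyP => V /Hs[_ ->].
apply/and3P; split.
- rewrite finset.eqEsubset; apply/andP; split.
    by apply/finset.bigcupsP => V /Hs[].
  by apply/fintype.subsetP => x /Hc[V VP xV]; apply/finset.bigcupP; exists V.
- apply/finset.trivIsetP => V W VP WP; apply: contraR.
  rewrite -finset.setI_eq0 => /finset.set0Pn[x]; rewrite inE => /andP[xV xW].
  by rewrite (Ht V W x).
- by apply/negP => /Hs[_]; rewrite cards0.
Qed.

Lemma NCpair_weight_nil w a b : (b <= a)%N -> NCpair_weight w a b = 1%R.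
Proof.
move=> ba; rewrite /NCpair_weight (big_pred1 finset.set0) ?big_set0// => P /=.
apply/idP/eqP => [/NCpairP[Hs _ _ _]|->].
  apply/eqP; rewrite -finset.subset0; apply/fintype.subsetP => V /Hs[].
  have -> : ord_itv a b = finset.set0.
    by apply/setP => x; rewrite !inE; apply/negP => /andP[]; lia.
  by rewrite finset.subset0 => /eqP ->; rewrite cards0.
apply/NCpairP; split=> [V|x|V W x|]; rewrite ?inE//.
  by move=> /andP[]; lia.
by apply/noncrossingP => V W x y z t; rewrite inE.
Qed.

Section Split.
Variables (i k : 'I_m) (b : nat).
Hypotheses (ik : (i < k)%N) (kb : (k < b)%N).

Let join (p : {set {set 'I_m}} * {set {set 'I_m}}) :=
  [set i; k] |: (p.1 :|: p.2).
Let left_itv := ord_itv i.+1 k.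
Let right_itv := ord_itv k.+1 b.
(** [P ::&: D] keeps the blocks contained in [D]. On the partitions having [[set i; k]] as a block,
    only that block is lost, and [join] puts it back. *)
Let split P := (P ::&: left_itv, P ::&: right_itv).

Let in_pair x : (x \in [set i; k]) = (x == i :> nat) || (x == k :> nat).
Proof. by rewrite !inE. Qed.

Let in_ord_itv (c d : nat) x : (x \in ord_itv c d) = (c <= x < d)%N.
Proof. by rewrite inE. Qed.

Let ik_neq : i != k. Proof. by rewrite neq_ltn ik. Qed.

(** A block with a point below [k] and a point above it would cross [[set i; k]], since [i] is the
    least point of the interval. *)
Let block_side P V : P \in NCpair i b -> [set i; k] \in P -> V \in P ->
  [\/ V = [set i; k], V \subset left_itv | V \subset right_itv].
Proof.
move=> /NCpairP[Hs Hc Ht /noncrossingP Hn] ikP VP.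
have [->|VD] := eqVneq V [set i; k]; first by constructor 1.
have [Vs /eqP] := Hs V VP.
have VDn x : x \in V -> (x != i :> nat) && (x != k :> nat).
  move=> xV; rewrite -negb_or -in_pair; apply/negP => xik.
  by move/eqP: VD; apply; exact: (Ht _ _ x).
have Vr x : x \in V -> (i <= x < b)%N.
  by move=> xV; rewrite -in_ord_itv; exact: (fintype.subsetP Vs).
have Hx x y : x \in V -> y \in V -> (x < k)%N -> (k < y)%N -> False.
  move=> xV yV xk ky; apply: (Hn [set i; k] V i x k y ikP VP) => //.
  - by rewrite eq_sym.
  - by rewrite in_pair eqxx.
  - by rewrite in_pair eqxx orbT.
  - by have := Vr x xV; have := VDn x xV; lia.
move=> /cards2P[x [y [xy VE]]].
have xV : x \in V by rewrite VE !inE eqxx.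
have yV : y \in V by rewrite VE !inE eqxx orbT.
have := VDn x xV; have := VDn y yV; have := Vr x xV; have := Vr y yV.
have := Hx x y xV yV; have := Hx y x yV xV.
move=> h1 h2 h3 h4 h5 h6.
have [xk|xk] := ltnP x k.
  constructor 2; apply/fintype.subsetP => t; rewrite VE in_ord_itv !inE.
  by move=> /orP[]/eqP->; lia.
constructor 3; apply/fintype.subsetP => t; rewrite VE in_ord_itv !inE.
by move=> /orP[]/eqP->; lia.
Qed.

Let restrict P c d : P \in NCpair i b ->
  (forall V x, V \in P -> x \in V -> x \in ord_itv c d -> V \subset ord_itv c d) ->
  ord_itv c d \subset ord_itv i b ->
  P ::&: ord_itv c d \in NCpair c d.
Proof.
move=> /NCpairP[Hs Hc Ht /noncrossingP Hn] HV sub.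
apply/NCpairP; split.
- by move=> V; rewrite inE => /andP[/Hs[_ ->] ->].
- move=> x xcd; have [V VP xV] := Hc x (fintype.subsetP sub _ xcd).
  by exists V => //; rewrite inE VP/= (HV V x).
- by move=> V W x; rewrite !inE => /andP[VP _] /andP[WP _]; exact: Ht.
- apply/noncrossingP => V W x y z t; rewrite !inE => /andP[VP _] /andP[WP _].
  exact: Hn.
Qed.

Let splitK P : P \in NCpair i b -> [set i; k] \in P -> join (split P) = P.
Proof.
move=> PN ikP; apply/setP => V; rewrite !inE.
apply/idP/idP => [/orP[/eqP->//|/orP[]/andP[]//]|VP].
by rewrite VP; have [->|->|->] := block_side PN ikP VP; rewrite ?eqxx ?orbT.
Qed.

Let split_in P : P \in NCpair i b -> [set i; k] \in P ->
  ((split P).1 \in NCpair i.+1 k) && ((split P).2 \in NCpair k.+1 b).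
Proof.
move=> PN ikP; apply/andP; split; apply: restrict => //.
- move=> V x VP xV; have [VE|//|VR] := block_side PN ikP VP.
    by move: xV; rewrite VE in_ord_itv in_pair; lia.
  by have := fintype.subsetP VR _ xV; rewrite !in_ord_itv; lia.
- by apply/fintype.subsetP => x; rewrite !in_ord_itv; lia.
- move=> V x VP xV; have [VE|VR|//] := block_side PN ikP VP.
    by move: xV; rewrite VE in_ord_itv in_pair; lia.
  by have := fintype.subsetP VR _ xV; rewrite !in_ord_itv; lia.
- by apply/fintype.subsetP => x; rewrite !in_ord_itv; lia.
Qed.

Section Join.
Variables (P1 P2 : {set {set 'I_m}}).
Hypotheses (P1N : P1 \in NCpair i.+1 k) (P2N : P2 \in NCpair k.+1 b).

Let inP1 V x : V \in P1 -> x \in V -> (i < x < k)%N.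
Proof.
move/NCpairP: P1N => [H _ _ _] /H[/fintype.subsetP H' _] /H'.
by rewrite in_ord_itv.
Qed.

Let inP2 V x : V \in P2 -> x \in V -> (k < x < b)%N.
Proof.
move/NCpairP: P2N => [H _ _ _] /H[/fintype.subsetP H' _] /H'.
by rewrite in_ord_itv.
Qed.

Let P1_nonempty V : V \in P1 -> exists x, x \in V.
Proof.
move/NCpairP: P1N => [H _ _ _] /H[_ V2]; apply/finset.set0Pn.
by rewrite -card_gt0 V2.
Qed.

Let P2_nonempty V : V \in P2 -> exists x, x \in V.
Proof.
move/NCpairP: P2N => [H _ _ _] /H[_ V2]; apply/finset.set0Pn.
by rewrite -card_gt0 V2.
Qed.

Let in_join V : V \in join (P1, P2) -> [\/ V = [set i; k], V \in P1 | V \in P2].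
Proof.
rewrite !inE /= => /orP[/eqP|/orP[]]; [exact: Or31|exact: Or32|exact: Or33].
Qed.

Lemma NCpair_join_in : join (P1, P2) \in NCpair i b.
Proof.
have /NCpairP[A1 A2 A3 /noncrossingP A4] := P1N.
have /NCpairP[B1 B2 B3 /noncrossingP B4] := P2N.
apply/NCpairP; split.
- move=> V /in_join[->|V1|V2].
  + split; last by rewrite cards2 ik_neq.
    by apply/fintype.subsetP => x; rewrite in_pair in_ord_itv; lia.
  + split; last by have [] := A1 V V1.
    by apply/fintype.subsetP => x /(inP1 V1); rewrite in_ord_itv; lia.
  + split; last by have [] := B1 V V2.
    by apply/fintype.subsetP => x /(inP2 V2); rewrite in_ord_itv; lia.
- move=> x; rewrite in_ord_itv => xib.
  have [xik|] := boolP (x \in [set i; k]).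
    by exists [set i; k] => //; rewrite !inE eqxx.
  rewrite in_pair => xik; have [xk|xk] := ltnP x k.
    have [|V V1 xV] := A2 x; first by rewrite in_ord_itv; lia.
    by exists V => //; rewrite !inE /= V1 orbT.
  have [|V V1 xV] := B2 x; first by rewrite in_ord_itv; lia.
  by exists V => //; rewrite !inE /= V1 !orbT.
- move=> V W x /in_join[->|V1|V2] /in_join[->|W1|W2] //.
  + by rewrite in_pair => h1 /(inP1 W1); lia.
  + by rewrite in_pair => h1 /(inP2 W2); lia.
  + by rewrite in_pair => /(inP1 V1); lia.
  + exact: A3.
  + by move=> /(inP1 V1) h /(inP2 W2); lia.
  + by rewrite in_pair => /(inP2 V2); lia.
  + by move=> /(inP2 V2) h /(inP1 W1); lia.
  + exact: B3.
- apply/noncrossingP => V W x y z t.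
  move=> /in_join[VE|V1|V2] /in_join[WE|W1|W2].
  + by rewrite VE WE eqxx.
  + rewrite VE !in_pair => _ ? /(inP1 W1) ? ? /(inP1 W1); lia.
  + rewrite VE !in_pair => _ ? /(inP2 W2) ? ? /(inP2 W2); lia.
  + rewrite WE !in_pair => _ /(inP1 V1) ? ? /(inP1 V1); lia.
  + exact: A4.
  + move=> _ /(inP1 V1) ? /(inP2 W2) ? /(inP1 V1) ? /(inP2 W2); lia.
  + rewrite WE !in_pair => _ /(inP2 V2) ? ? /(inP2 V2); lia.
  + move=> _ /(inP2 V2) ? /(inP1 W1) ? /(inP2 V2) ? /(inP1 W1); lia.
  + exact: B4.
Qed.

Lemma NCpair_joinK : split (join (P1, P2)) = (P1, P2).
Proof.
congr pair; apply/setP => V; rewrite inE; apply/andP/idP.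
- move=> [/in_join[->|//|V2] /fintype.subsetP Vs].
    by have := Vs i; rewrite in_pair in_ord_itv eqxx => /(_ isT); lia.
  have [x xV] := P2_nonempty V2.
  by have := Vs x xV; have := inP2 V2 xV; rewrite in_ord_itv; lia.
- move=> V1; split; first by rewrite !inE /= V1 orbT.
  by apply/fintype.subsetP => x /(inP1 V1); rewrite in_ord_itv.
- move=> [/in_join[->|V1|//] /fintype.subsetP Vs].
    by have := Vs i; rewrite in_pair in_ord_itv eqxx => /(_ isT); lia.
  have [x xV] := P1_nonempty V1.
  by have := Vs x xV; have := inP1 V1 xV; rewrite in_ord_itv; lia.
- move=> V1; split; first by rewrite !inE /= V1 !orbT.
  by apply/fintype.subsetP => x /(inP2 V1); rewrite in_ord_itv.
Qed.

Lemma NCpair_prod_join (w : {set 'I_m} -> R) :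
  (\prod_(V in join (P1, P2)) w V =
   w [set i; k] * (\prod_(V in P1) w V * \prod_(V in P2) w V))%R.
Proof.
rewrite /join /= big_setU1; last first.
  rewrite inE; apply/negP => /orP[V1|V2].
    by have := inP1 V1 (x := i); rewrite in_pair eqxx => /(_ isT); lia.
  by have := inP2 V2 (x := i); rewrite in_pair eqxx => /(_ isT); lia.
congr (_ * _)%R; rewrite -bigU/=.
  by apply: eq_bigl => V; rewrite !inE.
rewrite -finset.setI_eq0; apply/finset.set0Pn => -[V].
rewrite inE => /andP[V1 V2]; have [x xV] := P1_nonempty V1.
by have := inP1 V1 xV; have := inP2 V2 xV; lia.
Qed.

End Join.

(** [join] is a bijection from the pairs of partitions of the two remaining intervals, and weights
    multiply along it. *)
Lemma NCpair_weight_split (w : {set 'I_m} -> R) :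
  (\sum_(P in NCpair i b | [set i; k] \in P) \prod_(V in P) w V =
   w [set i; k] * (NCpair_weight w i.+1 k * NCpair_weight w k.+1 b))%R.
Proof.
rewrite /NCpair_weight big_distrlr/= pair_big/= big_distrr/=.
rewrite (reindex_onto join split); last first.
  by move=> P /andP[PN ikP]; exact: splitK.
apply: eq_big => [[P1 P2]|[P1 P2] /= ].
  apply/idP/idP => [/andP[/andP[PN ikP] /eqP E]|/andP[/= P1N P2N]].
    by have := split_in PN ikP; rewrite E.
  by rewrite NCpair_join_in// NCpair_joinK// eqxx !inE eqxx.
move=> /andP[/andP[PN ikP] /eqP E].
by have := split_in PN ikP; rewrite E /= => /andP[P1N P2N]; rewrite NCpair_prod_join.
Qed.
End Split.

Lemma NCpair_weight_rec (w : {set 'I_m} -> R) i b : (i < b)%N ->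
  NCpair_weight w i b = (\sum_(k : 'I_m | (i < k < b)%N)
    w [set i; k] * (NCpair_weight w i.+1 k * NCpair_weight w k.+1 b))%R.
Proof.
(* The partner of [i] in its block. The default value [i] lies outside the range [i < k < b] and is
   never attained on [NCpair i b]. *)
move=> ib; pose mate P := odflt i [pick k | (k != i) && ([set i; k] \in P)].
have mateE P k : P \in NCpair i b -> (i < k)%N ->
    (mate P == k) = ([set i; k] \in P).
  move=> /NCpairP[Hs Hc Ht _] ik; rewrite /mate; case: pickP => [l|no] /=.
    move=> /andP[li ilP]; apply/eqP/idP => [<-//|ikP].
    have := Ht _ _ i ilP ikP; rewrite !inE eqxx => /(_ isT isT) /setP/(_ l).
    by rewrite !inE (negbTE li) eqxx/= => /esym/eqP.
  have := no k; rewrite neq_ltn ik orbT/= => ->.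
  by apply/negbTE/eqP => /(congr1 val)/=; lia.
rewrite /NCpair_weight (partition_big mate (fun k : 'I_m => (i < k < b)%N)).
  apply: eq_bigr => k /andP[ik kb].
  rewrite -NCpair_weight_split//; apply: eq_bigl => P.
  by apply/andP/andP => -[PN]; rewrite mateE.
move=> P PN; have /NCpairP[Hs Hc Ht _] := PN.
have [|V VP iV] := Hc i; first by rewrite inE leqnn.
have [Vs /eqP/cards2P[x [y [xy VE]]]] := Hs V VP.
have [k [ki VE']] : exists k, k != i /\ V = [set i; k].
  move: iV; rewrite VE !inE => /orP[]/eqP ->; [exists y|exists x].
    by rewrite eq_sym.
  by rewrite finset.setUC.
have kr : (i < k < b)%N.
  have : k \in ord_itv i b by apply: (fintype.subsetP Vs); rewrite VE' !inE eqxx orbT.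
  move: ki; rewrite inE -val_eqE/=; lia.
have /eqP -> : mate P == k by rewrite mateE// -?VE'//; case/andP: kr.
exact: kr.
Qed.

End NoncrossingPairPartitions.

(** * Cumulant sums and the moment recursion *)

Section CumulantSum.
Context {R : comNzRingType} (lam : R).
Implicit Types (c M : nat -> R) (n : nat).

Definition cumulant_sum c n : R :=
  \sum_(P in NCeven n.*2) lam ^+ nb_even_min P * \prod_(V in P) c #|V|.

(** The boolean is read as 0 or 1, so that the power of [lam] in the cumulant formula becomes a
    product over the blocks. *)
Definition min_weight (m : nat) (V : {set 'I_m}) : R := lam ^+ even_min V.

(** The least point [i] stands for the integer [i.+1], hence the change of parity. *)
Lemma even_min_pair (m : nat) (i k : 'I_m) : (i < k)%N ->
  even_min [set i; k]%SET = odd i.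
Proof.
move=> ik; apply/'exists_andP/idP => [[x []]|oi].
  rewrite !inE => + /andP[/'forall_implyP H ox].
  move=> /orP[]/eqP xE; first by move: ox; rewrite xE /= negbK.
  by have := H i; rewrite !inE eqxx => /(_ isT); rewrite xE; lia.
exists i; rewrite !inE eqxx; split=> //; rewrite /= negbK oi andbT.
by apply/'forall_implyP => j; rewrite !inE => /orP[]/eqP->; lia.
Qed.

Lemma exp_nb_even_min (m : nat) (P : {set {set 'I_m}}) :
  lam ^+ nb_even_min P = \prod_(V in P) min_weight V.
Proof.
rewrite /min_weight /nb_even_min -prodr_const.
rewrite (eq_bigl (fun V => (V \in P) && even_min V)); last first.
  by move=> V; rewrite !inE.
by rewrite big_mkcondr; apply: eq_bigr => V _; case: even_min.
Qed.

Lemma sum_odd0 (F : nat -> R) n :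
  (forall j, (j < n.*2)%N -> odd j -> F j = 0) ->
  \sum_(0 <= j < n.*2.+1) F j = \sum_(0 <= t < n.+1) F t.*2.
Proof.
elim: n => [|n IH] F0; first by rewrite !big_nat1.
rewrite doubleS big_nat_recr//= big_nat_recr//= IH; last first.
  by move=> j jn; apply: F0; rewrite doubleS; lia.
rewrite [RHS]big_nat_recr//= (F0 n.*2.+1) ?addr0 ?doubleS//=.
by rewrite odd_double.
Qed.

(** The recursion of the Narayana polynomials 1, 1, 1 + lam, 1 + 3 lam + lam^2, ...: constant for
    lam = 0, Catalan numbers for lam = 1. The generating series satisfies M = 1 + z ((1 - lam) M +
    lam M^2). *)
Definition rect_recursion M := M 0%N = 1 /\ forall n,
  M n.+1 = (1 - lam) * M n + lam * \sum_(0 <= k < n.+1) M k * M (n - k)%N.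

Section Recursion.
Variables (M : nat -> R) (m : nat).
Hypothesis hM : rect_recursion M.

Let g (p : bool) n := if p && (0 < n)%N then lam * M n else M n.

(** The first pair has weight [lam ^+ p]; the points inside it start with the opposite parity, those
    after it with the parity [p]. For an even start, the empty inside is the only one without a
    factor [lam], which produces the summand [(1 - lam) * M n]; for an odd start, the empty outside
    plays this role. *)
Let g_rec (p : bool) n :
  lam ^+ p * \sum_(0 <= t < n.+1) g (~~ p) t * g p (n - t)%N = g p n.+1.
Proof.
have [M0 MS] := hM; rewrite /g andbT; case: p => /=.
  rewrite expr1 MS big_nat_recr//= subnn M0 mulr1; congr (_ * _).
  have -> : \sum_(0 <= t < n) M t * (if (0 < n - t)%N then lam * M (n - t)%N
      else M (n - t)%N) = lam * \sum_(0 <= t < n) M t * M (n - t)%N.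
    rewrite big_distrr/=; apply: eq_big_nat => t /andP[_ tn].
    by rewrite subn_gt0 tn; ring.
  by rewrite [in RHS]big_nat_recr//= subnn M0; ring.
rewrite expr0 mul1r MS big_nat_recl// [in RHS]big_nat_recl//= M0 subn0.
have -> : \sum_(0 <= i < n) lam * M i.+1 * M (n - i.+1)%N =
    lam * \sum_(0 <= i < n) M i.+1 * M (n - i.+1)%N.
  by rewrite big_distrr/=; apply: eq_bigr => t _; rewrite mulrA.
ring.
Qed.

(* Starting at an odd ordinal shifts the parity of every minimum, which
   multiplies the weight of a nonempty interval by [lam]. *)
Lemma NCpair_weight_min l a : (a + l <= m)%N ->
  NCpair_weight (@min_weight m) a (a + l)%N =
  if odd l then 0 else g (odd a) l./2.
Proof.
elim: l {-2}l (leqnn l) a => [|L IH] l lL a alm.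
  have -> : l = 0%N by lia.
  rewrite NCpair_weight_nil ?addn0//= /g ltnn andbF.
  by have [-> _] := hM.
case: l lL alm => [|l] lL alm.
  rewrite NCpair_weight_nil ?addn0//= /g ltnn andbF.
  by have [-> _] := hM.
have am : (a < m)%N by lia.
rewrite -[a in NCpair_weight _ a _]/(nat_of_ord (Ordinal am)).
rewrite NCpair_weight_rec//=; last by lia.
pose F k := lam ^+ odd a * (NCpair_weight (@min_weight m) a.+1 k *
  NCpair_weight (@min_weight m) k.+1 (a + l.+1)%N).
rewrite (eq_bigr (fun k : 'I_m => F k)); last first.
  by move=> k /andP[ak kl]; rewrite /min_weight even_min_pair.
rewrite -(big_mkord (fun k => a < k < a + l.+1)%N F).
have -> : \sum_(0 <= k < m | (a < k < a + l.+1)%N) F k =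
    \sum_(0 <= j < l) F (j + a.+1)%N.
  transitivity (\sum_(a.+1 <= k < a + l.+1) F k); last first.
    by rewrite -{1}[a.+1]add0n big_addn (_ : (a + l.+1 - a.+1)%N = l)//; lia.
  rewrite [RHS](@big_nat_widenl _ _ _ _ 0%N)//.
  rewrite [RHS](@big_nat_widen _ _ _ _ (a + l.+1)%N m)//.
(* [j] points lie inside the first pair and [l.-1 - j] after it; the term vanishes unless both
   numbers are even. *)
have FE j : (j < l)%N -> F (j + a.+1)%N =
    if odd j || odd (l.-1 - j) then 0 else
    lam ^+ odd a * (g (~~ odd a) j./2 * g (odd a) (l.-1 - j)./2).
  move=> jl; rewrite /F [(j + _)%N]addnC IH; [|lia..].
  have -> : (a + l.+1 = (a.+1 + j).+1 + (l.-1 - j))%N by lia.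
  rewrite IH; [|lia..]; case: ifP => oj /=; first by rewrite mul0r mulr0.
  case: ifP => // olj; first by rewrite !mulr0.
  by congr (_ * (_ * g _ _)); rewrite oddD/= oj addbF negbK.
have [ol|ol] := boolP (odd l); last first.
  rewrite big_nat big1// => j /andP[_ jl]; rewrite FE//.
  have -> // : odd j || odd (l.-1 - j) by lia.
have [n ln] : exists n, l = n.*2.+1 by exists l./2; lia.
rewrite ln sum_odd0; last first.
  by move=> j jn oj; rewrite FE ?oj//; lia.
rewrite /= doubleK -g_rec big_distrr/=.
apply: eq_big_nat => t /andP[_ tn]; rewrite FE; last by lia.
rewrite ln /= -doubleB !odd_double !doubleK.
by [].
Qed.
End Recursion.

(** Blocks are nonempty and even, so [c] gives weight 0 to a partition with a block of size other
    than 2, and weight 1 to a pair partition. *)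
Lemma cumulant_sum_min_weight M : rect_recursion M ->
  forall n c, (forall k, (0 < k)%N -> c k.*2 = (k == 1%N)%:R) ->
  cumulant_sum c n = M n.
Proof.
move=> hM n c cE; have := @NCpair_weight_min M n.*2 hM n.*2 0 (leqnn _).
rewrite add0n odd_double doubleK /= => <-.
rewrite /cumulant_sum /NCpair_weight.
rewrite [RHS]big_mkcond [LHS]big_mkcond/=; apply: eq_bigr => P _.
have T0 : ord_itv 0 n.*2 = [set: 'I_n.*2]%SET.
  by apply/setP => x; rewrite !inE ltn_ord.
have pairE : (P \in NCpair 0 n.*2) =
    (P \in NCeven n.*2) && [forall V in P, #|V| == 2].
  rewrite !inE T0; case: (boolP [forall V in P, #|V| == 2]) => H.
    rewrite !andbT; suff -> : [forall V in P, ~~ odd #|V|] by rewrite andbT.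
    apply/'forall_implyP => V VP.
    by have /'forall_implyP/(_ V VP)/eqP -> := H.
  by rewrite !andbF.
rewrite pairE; case: ifP => //= PE.
have [H|H] := boolP [forall V in P, #|V| == 2].
  rewrite exp_nb_even_min [X in _ * X]big1 ?mulr1// => V VP.
  by have /'forall_implyP/(_ V VP)/eqP -> := H; exact: (cE 1%N).
have /forallPn[V] := H; rewrite negb_imply => /andP[VP V2].
rewrite (bigD1 V)//=.
have /and3P[/and3P[_ _ P0] _ /'forall_implyP/(_ V VP) oV] :
    [&& finset.partition P [set: 'I_n.*2], noncrossing P
      & [forall V in P, ~~ odd #|V|]].
  by move: PE; rewrite inE.
have V0 : (0 < #|V|)%N.
  by rewrite card_gt0; apply: contraNneq P0 => <-.
have -> : #|V| = #|V|./2.*2 by lia.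
rewrite cE; last by lia.
by rewrite (_ : (_ == _) = false) ?mul0r ?mulr0//; lia.
Qed.

(** The moment-cumulant relation is triangular: the one-block partition contributes [c n.*2] with
    coefficient 1, as its minimum is the odd number 1, and all other partitions involve smaller
    orders only. *)
Lemma cumulant_sum_inj c c' :
  (forall n, (0 < n)%N -> cumulant_sum c n = cumulant_sum c' n) ->
  forall n, (0 < n)%N -> c n.*2 = c' n.*2.
Proof.
move=> cc'; elim/ltn_ind => n IH n0.
pose T := [set [set: 'I_n.*2]]%SET.
have TN : T \in NCeven n.*2.
  rewrite inE; apply/and3P; split.
  - apply/and3P; split.
    + by rewrite cover1.
    + by apply/finset.trivIsetP => V W; rewrite !inE => /eqP-> /eqP->; rewrite eqxx.
    + have i0 : (0 < n.*2)%N by lia.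
      by rewrite inE; apply/eqP => /setP/(_ (Ordinal i0)); rewrite !inE.
  - apply/noncrossingP => V W x y z t; rewrite !inE => /eqP -> /eqP ->.
    by rewrite eqxx.
  - apply/'forall_implyP => V; rewrite inE => /eqP ->.
    by rewrite cardsT card_ord odd_double.
have sumE (d : nat -> R) : cumulant_sum d n = d n.*2 +
    \sum_(P in NCeven n.*2 | P != T) lam ^+ nb_even_min P * \prod_(V in P) d #|V|.
  rewrite /cumulant_sum (bigD1 T)//=; congr (_ + _).
  rewrite big_set1 cardsT card_ord exp_nb_even_min big_set1 /min_weight.
  rewrite (_ : even_min _ = false) ?mul1r//.
  apply/negbTE/'exists_andP => -[i [_ /andP[/'forall_implyP H]]].
  have i0 : (0 < n.*2)%N by lia.
  have := H (Ordinal i0); rewrite inE => /(_ isT)/=.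
  by rewrite leqn0 => /eqP ->.
have := cc' n n0; rewrite !sumE => /eqP.
rewrite (eq_bigr (fun P : {set {set 'I_n.*2}} =>
    lam ^+ nb_even_min P * \prod_(V in P) c' #|V|)).
  by move=> /eqP/addIr.
move=> P /andP[PN PT]; congr (_ * _); apply: eq_bigr => V VP.
move: PN; rewrite inE => /and3P[].
move=> /and3P[/eqP Pc /finset.trivIsetP Pt P0] _ /'forall_implyP/(_ V VP) oV.
have V0 : (0 < #|V|)%N by rewrite card_gt0; apply: contraNneq P0 => <-.
have -> : #|V| = #|V|./2.*2 by lia.
apply: IH; last by lia.
suff : (#|V| < n.*2)%N by lia.
rewrite ltn_neqAle; apply/andP; split; last first.
  by rewrite -[leqRHS](card_ord n.*2) max_card.
apply: contra PT => /eqP Vn.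
have VT : V = [set: 'I_n.*2]%SET.
  by apply/eqP; rewrite eqEcard finset.subsetT cardsT card_ord Vn leqnn.
rewrite /T -VT finset.eqEsubset; apply/andP; split; last first.
  by apply/fintype.subsetP => W; rewrite inE => /eqP ->.
apply/fintype.subsetP => W WP; rewrite inE; apply: contraT => WV.
have := Pt _ _ WP VP WV; rewrite -finset.setI_eq0 VT finset.setIT => /eqP W0.
by move: P0; rewrite -W0 WP.
Qed.
End CumulantSum.

(** * Limits of integrals *)

Section RintegralConvergence.
Context {d : measure_display} {T : measurableType d} {R : realType}.
Context {mu : {measure set T -> \bar R}}.
Implicit Types (f g : T -> R).

Lemma cvg_Rintegral_dominated (D : set T) (f_ : nat -> T -> R) f g : measurable D ->
  (forall n, measurable_fun D (f_ n)) ->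
  mu.-integrable D (EFin \o g) ->
  (forall n x, D x -> `|f_ n x| <= g x) ->
  (forall x, D x -> f_ n x @[n --> \oo] --> f x) ->
  mu.-integrable D (EFin \o f) /\
  \int[mu]_(x in D) f_ n x @[n --> \oo] --> \int[mu]_(x in D) f x.
Proof.
move=> mD mf_ ig fg cf.
have mf : measurable_fun D f.
  exact: (@measurable_fun_cvg _ _ _ _ f_ f mf_ cf).
have [|||||intf _ cvgf] := @dominated_convergence _ _ _ mu D mD
  (fun n x => (f_ n x)%:E) (EFin \o f) (EFin \o g).
- by move=> n; exact/measurable_EFinP.
- exact/measurable_EFinP.
- by apply/aeW => x Dx; apply/cvg_EFin; [exact: nearW|exact: cf].
- exact: ig.
- by apply/aeW => x n Dx; rewrite lee_fin; exact: fg.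
split=> //; apply: fine_cvg; rewrite fineK; first exact: cvgf.
exact: integrable_fin_num.
Qed.

(** Serves to prove that a moment is finite, at a stage where the damped integrals converge but no
    dominating function is available. *)
Lemma integrable_fatou (f_ : nat -> T -> R) f (l : R) :
  (forall n, measurable_fun setT (f_ n)) -> (forall n x, 0 <= f_ n x) ->
  (forall n, mu.-integrable setT (EFin \o f_ n)) ->
  (forall x, f_ n x @[n --> \oo] --> f x) ->
  \int[mu]_x f_ n x @[n --> \oo] --> l ->
  mu.-integrable setT (EFin \o f).
Proof.
move=> mf_ f0 if_ cf cl.
have mf : measurable_fun setT f.
  by apply: (@measurable_fun_cvg _ _ _ _ f_ f mf_) => x _; exact: cf.
have f_ge0 x : 0 <= f x.
  by apply: (cvgr_to_ge (cf x)); apply: nearW => n; exact: f0.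
apply/integrableP; split; first exact/measurable_EFinP.
have -> : (\int[mu]_x `|(EFin \o f) x|)%E =
    (\int[mu]_x limn_einf (fun n => (f_ n x)%:E))%E.
  apply: eq_integral => x _; rewrite /= ger0_norm//.
  by have /cvg_limn_einf_sup[-> _] : (f_ n x)%:E @[n --> \oo] --> (f x)%:E
    by apply/cvg_EFin; [exact: nearW|exact: cf].
apply: (le_lt_trans (@fatou _ _ _ mu _ measurableT (fun n x => (f_ n x)%:E) _ _)).
- by move=> n; exact/measurable_EFinP.
- by move=> n x _; rewrite lee_fin.
rewrite (_ : limn_einf _ = l%:E) ?ltry//.
have /cvg_limn_einf_sup[//] : (\int[mu]_x (f_ n x)%:E)%E @[n --> \oo] --> l%:E.
apply/fine_cvgP; split; last exact: cl.
by apply: nearW => n; apply: integrable_fin_num => //; exact: if_.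
Qed.
End RintegralConvergence.

Lemma cvg_sum_nat {R : realType} (F : nat -> nat -> R) (l : nat -> R) N :
  (forall j, (j < N)%N -> F j k @[k --> \oo] --> l j) ->
  \sum_(0 <= j < N) F j k @[k --> \oo] --> \sum_(0 <= j < N) l j.
Proof.
elim: N => [|N IH] Fl.
  by rewrite big_geq//; under eq_fun do rewrite big_geq//; exact: cvg_cst.
rewrite big_nat_recr//=; under eq_fun do rewrite big_nat_recr//=.
by apply: cvgD; [apply: IH => j jN; apply: Fl; exact: ltnW|exact: Fl].
Qed.

(** * Moments from the transform equation *)

Section TransformMoments.
Context {R : realType}.
Implicit Types (nu : prob R) (lam u x : R) (n : nat).

(** These are the Taylor remainders at u = 0 of the transform of order 0: after n terms the
    remainder is (-u)^n times this integral. At order 0 it equals G(1/(iv)) / (iv) for u = v^2, with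
    G the Cauchy transform. *)
Definition moment_transform nu n u : R :=
  \int[nu]_x (x ^+ n.*2 / (1 + u * x ^+ 2)).

Lemma denom_gt0 u x : 0 <= u -> 0 < 1 + u * x ^+ 2.
Proof. by move=> u0; rewrite ltr_pwDl// mulr_ge0// sqr_ge0. Qed.

Lemma expr_double_ge0 x n : 0 <= x ^+ n.*2.
Proof. by rewrite -mul2n exprM exprn_ge0// sqr_ge0. Qed.

Lemma measurable_moment_transform n u : 0 <= u ->
  measurable_fun setT (fun x : R => x ^+ n.*2 / (1 + u * x ^+ 2)).
Proof.
move=> u0; apply: measurable_funM => //; apply: continuous_measurable_fun => x.
apply: cvgV; first by rewrite gt_eqF// denom_gt0.
apply: cvgD; first exact: cvg_cst.
by apply: cvgM; [exact: cvg_cst|exact: exprn_continuous].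
Qed.

Lemma moment_transform_bound n u x : 0 <= u ->
  `|x ^+ n.*2 / (1 + u * x ^+ 2)| <= x ^+ n.*2.
Proof.
move=> u0; have D0 := denom_gt0 x u0.
have x0 := expr_double_ge0 x n.
rewrite ger0_norm; last by rewrite divr_ge0// ltW.
by rewrite ler_pdivrMr// ler_peMr// lerDl mulr_ge0// sqr_ge0.
Qed.

Lemma integrable_moment_transform nu n u : 0 <= u ->
  nu.-integrable setT (fun x : measurableTypeR R => (x ^+ n.*2)%:E) ->
  nu.-integrable setT (EFin \o (fun x : measurableTypeR R => x ^+ n.*2 / (1 + u * x ^+ 2))).
Proof.
move=> u0; apply: le_integrable => //.
  by apply/measurable_EFinP; exact: measurable_moment_transform.
move=> x _ /=; rewrite lee_fin [leRHS]ger0_norm ?expr_double_ge0//.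
exact: moment_transform_bound.
Qed.

Section Step.
Context {nu : prob R} {n : nat}.
Hypothesis int_n :
  nu.-integrable setT (fun x : measurableTypeR R => (x ^+ n.*2)%:E).

Lemma moment_transformS_E u x : 0 < u -> x ^+ n.+1.*2 / (1 + u * x ^+ 2) =
  u^-1 * (x ^+ n.*2 - x ^+ n.*2 / (1 + u * x ^+ 2)).
Proof.
move=> u0; have D0 := denom_gt0 x (ltW u0).
rewrite doubleS -addn2 exprD; field.
by rewrite !gt_eqF.
Qed.

(** For [u > 0] the denominator compensates two powers of [x], so a finite moment of order [n.*2]
    suffices for the transform of order [n.+1]. *)
Lemma integrable_moment_transformS u : 0 < u ->
  nu.-integrable setT (EFin \o (fun x : measurableTypeR R => x ^+ n.+1.*2 / (1 + u * x ^+ 2))).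
Proof.
move=> u0; apply: (@eq_integrable _ _ _ nu _ measurableT
  (fun x => (u^-1)%:E * ((x ^+ n.*2)%:E - (x ^+ n.*2 / (1 + u * x ^+ 2))%:E))%E).
  by move=> x _ /=; rewrite moment_transformS_E.
apply: integrableZl => //; apply: integrableB => //.
exact: integrable_moment_transform (ltW u0) _.
Qed.

Lemma moment_transformS u : 0 < u ->
  u * moment_transform nu n.+1 u = moment nu n.*2 - moment_transform nu n u.
Proof.
move=> u0; rewrite /moment_transform /moment -RintegralB//; last first.
  exact: integrable_moment_transform (ltW u0) _.
rewrite -RintegralZl//; last exact: integrable_moment_transformS.
apply: eq_Rintegral => x _; rewrite moment_transformS_E// mulrA divff ?mul1r//.
by rewrite gt_eqF.
Qed.
End Step.

Lemma cvg_denom (u_ : nat -> R) n x : u_ k @[k --> \oo] --> (0 : R) ->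
  x ^+ n.*2 / (1 + u_ k * x ^+ 2) @[k --> \oo] --> x ^+ n.*2.
Proof.
move=> u0; rewrite -[X in _ --> X]mulr1 -[X in _ * X]invr1.
apply: cvgM; first exact: cvg_cst.
apply: cvgV; first by rewrite oner_eq0.
rewrite -[X in _ --> X](_ : 1 + 0 * x ^+ 2 = 1); last by ring.
by apply: cvgD; [exact: cvg_cst|apply: cvgM => //; exact: cvg_cst].
Qed.

Lemma cvg_moment_transform nu (u_ : nat -> R) n :
  (forall k, 0 <= u_ k) -> u_ k @[k --> \oo] --> (0 : R) ->
  nu.-integrable setT (fun x : measurableTypeR R => (x ^+ n.*2)%:E) ->
  moment_transform nu n (u_ k) @[k --> \oo] --> moment nu n.*2.
Proof.
move=> u_ge0 u0 int_n.
apply: (@cvg_Rintegral_dominated _ _ _ nu setT _ _ (fun x => x ^+ n.*2) _ _ _ _ _).2 => //.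
- by move=> k; exact: measurable_moment_transform.
- by move=> k x _; exact: moment_transform_bound.
- by move=> x _; exact: cvg_denom.
Qed.

Lemma moment0 nu : moment nu 0 = 1.
Proof.
rewrite /moment; under eq_Rintegral do rewrite expr0.
by rewrite Rintegral_cst// [X in fine X](probability_setT nu) mulr1.
Qed.

Lemma integrable_moment0 nu :
  nu.-integrable setT (fun x : measurableTypeR R => (x ^+ 0)%:E).
Proof.
exact: (finite_measure_integrable_cst nu 1 measurableT).
Qed.

Section RectEquation.
Context {nu : prob R} {lam : R} {u_ : nat -> R}.
Hypothesis u_gt0 : forall k, 0 < u_ k.
Hypothesis u_cvg0 : u_ k @[k --> \oo] --> (0 : R).
Let F n k := moment_transform nu n (u_ k).
Hypothesis F_eq : forall k,
  u_ k * (lam * F 0 k ^+ 2 + (1 - lam) * F 0 k) = 1 - F 0 k.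

Let m n := moment nu n.*2.

(** The equation after [n] Taylor steps: in each product at least one factor is a moment or the
    transform of order 0. In the limit u -> 0 it becomes [rec_rhs n]. *)
Let rhs n k := (1 - lam) * F n k +
  lam * (\sum_(0 <= j < n) m j * F (n - j) k + F n k * F 0 k).

Let rec_rhs n := (1 - lam) * m n + lam * \sum_(0 <= j < n.+1) m j * m (n - j)%N.

Let int n := nu.-integrable setT (fun x : measurableTypeR R => (x ^+ n.*2)%:E).

Let cvgF n : int n -> F n k @[k --> \oo] --> m n.
Proof.
by move=> ?; apply: cvg_moment_transform => // k; exact: ltW.
Qed.

(** The three claims must advance together. The formula for [F n.+1] makes it converge, so Fatou's
    lemma makes the next moment finite; dominated convergence then identifies this moment with the
    limit; and comparing both sides after multiplication by [u_ k] gives the formula for the next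
    transform. *)
Lemma transform_moments_step n : [/\ (forall j, (j <= n)%N -> int j),
    (forall k, F n.+1 k = rhs n k) & forall j, (j < n)%N -> m j.+1 = rec_rhs j] .
Proof.
have m0 : m 0%N = 1 by exact: moment0.
elim: n => [|n [IHi IHF IHm]].
  split=> //; first by move=> j; rewrite leqn0 => /eqP ->; exact: integrable_moment0.
  move=> k; have := moment_transformS (n := 0) (integrable_moment0 nu) (u_gt0 k).
  rewrite -/(F 1 k) -/(F 0 k) -/(m 0%N) m0 -F_eq => /mulfI -> //; last first.
    by rewrite gt_eqF.
  by rewrite /rhs big_geq//; ring.
have cvg_rhs : rhs n k @[k --> \oo] --> rec_rhs n.
  rewrite /rhs /rec_rhs big_nat_recr//= subnn m0 mulr1.
  apply: cvgD; first by apply: cvgM; [exact: cvg_cst|exact/cvgF/IHi].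
  apply: cvgM; first exact: cvg_cst.
  apply: cvgD; last first.
    have -> : m n = m n * m 0%N by rewrite m0 mulr1.
    by apply: cvgM; apply: cvgF; exact: IHi.
  apply: cvg_sum_nat => j _; apply: cvgM; first exact: cvg_cst.
  by apply: cvgF; apply: IHi; exact: leq_subr.
have cvgFS : F n.+1 k @[k --> \oo] --> rec_rhs n.
  by rewrite (_ : F n.+1 = rhs n)//; apply/funext => k; exact: IHF.
have intS : int n.+1.
  apply: (@integrable_fatou _ _ _ nu
    (fun k x => x ^+ n.+1.*2 / (1 + u_ k * x ^+ 2)) _ (rec_rhs n)).
  - by move=> k; apply: measurable_moment_transform; exact: ltW.
  - move=> k x; rewrite divr_ge0 ?expr_double_ge0//.
    by apply: ltW; apply: denom_gt0; exact: ltW.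
  - by move=> k; apply: integrable_moment_transformS => //; exact: IHi.
  - by move=> x; exact: cvg_denom.
  - exact: cvgFS.
have mS : m n.+1 = rec_rhs n.
  exact: (cvg_unique _ (cvgF intS) cvgFS).
split.
- by move=> j; rewrite leq_eqVlt => /orP[/eqP->//|]; rewrite ltnS; exact: IHi.
- move=> k; have u0 : u_ k != 0 by rewrite gt_eqF.
  have S j : (j <= n.+1)%N -> u_ k * F j.+1 k = m j - F j k.
    move=> jn; apply: moment_transformS => //.
    by move: jn; rewrite leq_eqVlt => /orP[/eqP->//|]; rewrite ltnS; exact: IHi.
  apply: (mulfI u0); rewrite S// mS IHF /rhs /rec_rhs.
  rewrite !mulrDr [u_ k * (_ * F n.+1 k)]mulrCA S// mulrCA [u_ k * (lam * _)]mulrCA.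
  have -> : u_ k * \sum_(0 <= j < n.+1) m j * F (n.+1 - j)%N k =
     \sum_(0 <= j < n.+1) m j * m (n - j)%N - \sum_(0 <= j < n.+1) m j * F (n - j)%N k.
    rewrite big_distrr/= -sumrB; apply: eq_big_nat => j /andP[_ jn].
    by rewrite subSn// mulrCA S ?mulrBr//; lia.
  have -> : u_ k * (lam * (F n.+1 k * F 0 k)) = lam * (u_ k * F n.+1 k * F 0 k).
    by ring.
  rewrite S// [\sum_(0 <= j < n.+1) m j * F (n - j)%N k]big_nat_recr//= subnn.
  ring.
- by move=> j; rewrite ltnS leq_eqVlt => /orP[/eqP->//|]; exact: IHm.
Qed.

Lemma transform_moments_integrable n :
  nu.-integrable setT (fun x : measurableTypeR R => (x ^+ n.*2)%:E).
Proof. by have [/(_ n (leqnn n))] := transform_moments_step n. Qed.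

Lemma transform_rect_recursion : rect_recursion lam (fun n => moment nu n.*2).
Proof.
split; first exact: moment0.
by move=> n; have [_ _ /(_ n (ltnSn n))] := transform_moments_step n.+1.
Qed.
End RectEquation.
End TransformMoments.

Lemma rect_recursion_unique {R : comNzRingType} (lam : R) (M M' : nat -> R) :
  rect_recursion lam M -> rect_recursion lam M' -> M =1 M'.
Proof.
move=> [M0 MS] [M'0 M'S]; elim/ltn_ind => -[_|n IH]; first by rewrite M0.
rewrite MS M'S IH//; congr (_ + _ * _); apply: eq_big_nat => k /andP[_ kn].
by rewrite !IH//; lia.
Qed.

(** * Polynomials approximating an indicator function *)

Section IndicatorApproximation.
Context {R : realType}.
Implicit Types (y a : R) (n : nat).

Lemma bernoulli_inequality a n : -1 <= a -> 1 + n%:R * a <= (1 + a) ^+ n.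
Proof.
move=> a1; elim: n => [|n IH]; first by rewrite mul0r addr0 expr0.
rewrite exprS; apply: (@le_trans _ _ ((1 + a) * (1 + n%:R * a))).
  rewrite -natr1; have : 0 <= n%:R * (a * a) by rewrite mulr_ge0// -expr2 sqr_ge0.
  by nra.
by apply: ler_wpM2l => //; lra.
Qed.

(** Bernoulli's inequality bounds 1 + n a by (1 + a)^n, and (1 - a)(1 + a) <= 1. *)
Lemma onem_expr_le a n : 0 <= a -> a <= 1 -> (1 - a) ^+ n <= (1 + n%:R * a)^-1.
Proof.
move=> a0 a1; have D0 : 0 < 1 + n%:R * a by rewrite ltr_pwDl// mulr_ge0.
rewrite -[leRHS]mul1r ler_pdivlMr//.
apply: (@le_trans _ _ ((1 - a) ^+ n * (1 + a) ^+ n)).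
  apply: ler_wpM2l; first by rewrite exprn_ge0// subr_ge0.
  by apply: bernoulli_inequality; lra.
rewrite -exprMn (_ : (1 - a) * (1 + a) = 1 - a ^+ 2); last by ring.
rewrite exprn_ile1//; first by rewrite subr_ge0 exprn_ile1.
by rewrite lerBlDr lerDl sqr_ge0.
Qed.

(* Converges on [0, 1] to the indicator of [0, 1/2]: the exponents are such
   that 2^(N (N - 1)) y^(N^2) = (2 y)^(N^2) / 2^N tends to 0 for y <= 1/2 and
   to infinity for y > 1/2. *)
Definition step_approx n : {poly R} :=
  (1 - 'X^(n.+1 * n.+1)) ^+ (2 ^ (n.+1 * n))%N.

Lemma step_approxE n y :
  (step_approx n).[y] = (1 - y ^+ (n.+1 * n.+1)) ^+ (2 ^ (n.+1 * n))%N.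
Proof. by rewrite /step_approx horner_exp hornerD hornerN hornerXn hornerE. Qed.

Lemma step_approx_ge0 n y : 0 <= y <= 1 -> 0 <= (step_approx n).[y].
Proof.
move=> /andP[y0 y1]; rewrite step_approxE exprn_ge0// subr_ge0.
by rewrite exprn_ile1.
Qed.

Lemma step_approx_le1 n y : 0 <= y <= 1 -> (step_approx n).[y] <= 1.
Proof.
move=> /andP[y0 y1]; rewrite step_approxE exprn_ile1//.
  by rewrite subr_ge0 exprn_ile1.
by rewrite lerBlDr lerDl exprn_ge0.
Qed.

Lemma step_approx_scale n y :
  (2 ^ (n.+1 * n))%:R * y ^+ (n.+1 * n.+1) = ((2 * y) ^+ n.+1 / 2) ^+ n.+1.
Proof.
rewrite natrX expr_div_n -exprM exprMn.
have -> : (2 : R) ^+ (n.+1 * n.+1) = 2 ^+ (n.+1 * n) * 2 ^+ n.+1.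
  by rewrite -exprD mulnS addnC.
by field; rewrite expf_neq0.
Qed.

Lemma cvg_step_approx_low y : 0 <= y <= 2^-1 ->
  (step_approx n).[y] @[n --> \oo] --> (1 : R).
Proof.
move=> /andP[y0 y2].
have y01 : 0 <= y <= 1 by apply/andP; split=> //; lra.
apply: (@squeeze_cvgr _ _ _ _ (fun n => 1 - geometric (2^-1) 2^-1 n) (cst 1)).
- apply: nearW => n; rewrite step_approx_le1// andbT step_approxE.
  (* For y <= 1/2 the scaled power is at most (1/2)^(n+1), which is the geometric term of the lower
     bound. *)
  apply: (@le_trans _ _ (1 + (2 ^ (n.+1 * n))%:R * - y ^+ (n.+1 * n.+1))).
    rewrite mulrN lerD2l lerN2 step_approx_scale /geometric/= -exprS.
    apply: lerXn2r; rewrite ?nnegrE//.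
      by rewrite divr_ge0// exprn_ge0// mulr_ge0.
    rewrite ler_pdivrMr// mulVf// exprn_ile1//; first by rewrite mulr_ge0.
    by lra.
  apply: bernoulli_inequality; rewrite lerN2.
  by apply: exprn_ile1 => //; lra.
- rewrite -[X in _ --> X]subr0; apply: cvgB; first exact: cvg_cst.
  by apply: cvg_geometric; rewrite ger0_norm; lra.
- exact: cvg_cst.
Qed.

Lemma cvg_step_approx_high y : 2^-1 < y <= 1 ->
  (step_approx n).[y] @[n --> \oo] --> (0 : R).
Proof.
move=> /andP[y2 y1].
have y01 : 0 <= y <= 1 by apply/andP; split=> //; lra.
(* The constant 3 makes (2y)^(n+1) >= 1 + 3 = 4 for n >= N, so that half of it is still at least
   2. *)
have [N HN] : exists N : nat, 3 <= N%:R * (2 * y - 1).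
  have w0 : 0 < 2 * y - 1 by lra.
  exists (Num.bound (3 / (2 * y - 1))).
  rewrite -ler_pdivrMr//; apply: ltW; apply: archi_boundP.
  by rewrite divr_ge0// ltW.
apply: (@squeeze_cvgr _ _ _ _ (cst 0) (geometric 1 2^-1)).
- near=> n; rewrite step_approx_ge0//= step_approxE.
  have yN0 : 0 <= y ^+ (n.+1 * n.+1) by rewrite exprn_ge0//; lra.
  apply: le_trans (onem_expr_le _ _ _) _ => //; first by apply: exprn_ile1; lra.
  rewrite step_approx_scale mul1r exprVn lef_pV2 ?posrE ?exprn_gt0//; last first.
    by rewrite ltr_pwDl// exprn_ge0// divr_ge0// exprn_ge0//; lra.
  apply: (@le_trans _ _ (2 ^+ n.+1)).
    by rewrite exprS ler_peMl ?exprn_ge0// ler1n.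
  rewrite -[leLHS]add0r lerD//; apply: lerXn2r; rewrite ?nnegrE//.
    by rewrite divr_ge0// exprn_ge0//; lra.
  rewrite ler_pdivlMr// (_ : 2 * 2 = 1 + 3); last by ring.
  have -> : 2 * y = 1 + (2 * y - 1) by ring.
  apply: le_trans (bernoulli_inequality _ _); last by lra.
  rewrite lerD2l; apply: (le_trans HN); apply: ler_wpM2r; first by lra.
  by rewrite ler_nat leqW//; near: n; exact: nbhs_infty_ge.
- exact: cvg_cst.
- by apply: cvg_geometric; rewrite ger0_norm; lra.
Unshelve. all: by end_near.
Qed.
End IndicatorApproximation.

(** * Determination of a compactly supported measure by its moments *)

Section MomentDetermination.
Context {R : realType}.
Implicit Types (mu nu : prob R) (K : R).

Lemma integrable_continuous_segment (mu : finmeas R) (f : R -> R) (a b : R) :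
  continuous f -> mu.-integrable `[a, b] (EFin \o f).
Proof.
move=> cf; apply: measurable_bounded_integrable => //.
- rewrite ltey_eq; apply/orP; left; exact: fin_num_measure.
- by apply: measurable_funTS; exact: continuous_measurable_fun.
- have /compact_bounded[M [_ mrt]] :=
    continuous_compact (continuous_subspaceT cf) (@segment_compact _ a b).
  by exists M; split; rewrite ?num_real // => ? ? ? ?; exact: mrt.
Qed.

Lemma eq_Rintegral_horner mu nu K :
  (forall n, \int[mu]_(x in `[- K, K]) x ^+ n = \int[nu]_(x in `[- K, K]) x ^+ n) ->
  forall p : {poly R},
    \int[mu]_(x in `[- K, K]) p.[x] = \int[nu]_(x in `[- K, K]) p.[x].
Proof.
move=> munu p.
have RintE (m : prob R) (q : {poly R}) c k :
    \int[m]_(x in `[- K, K]) (x ^+ k * (q * 'X + c%:P).[x]) =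
    \int[m]_(x in `[- K, K]) (x ^+ k.+1 * q.[x]) + c * \int[m]_(x in `[- K, K]) x ^+ k.
  rewrite -RintegralZl//; last first.
    by apply: integrable_continuous_segment; exact: exprn_continuous.
  rewrite -RintegralD//.
  - by apply: eq_Rintegral => x _; rewrite !hornerE exprS; ring.
  - apply: integrable_continuous_segment => x.
    by apply: cvgM; [exact: exprn_continuous|exact: continuous_horner].
  - apply: integrable_continuous_segment => x.
    by apply: cvgM; [exact: cvg_cst|exact: exprn_continuous].
(* The extra factor [x ^+ k] absorbs the multiplication by ['X] in the induction on [p]. *)
suff H k : \int[mu]_(x in `[- K, K]) (x ^+ k * p.[x]) =
    \int[nu]_(x in `[- K, K]) (x ^+ k * p.[x]).
  have := H 0%N; under eq_Rintegral do rewrite expr0 mul1r.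
  by under [in X in _ = X -> _]eq_Rintegral do rewrite expr0 mul1r.
elim/poly_ind: p k => [|p c IH] k; last by rewrite !RintE IH munu.
transitivity (0 : R); [|symmetry]; under eq_Rintegral do rewrite horner0 mulr0;
  by rewrite Rintegral_cst// mul0r.
Qed.

(** The affine map sends [t] to 1/2 and the segment into [0, 1]: with c = K + 2|t| + 1 one has x + c
    >= 0, t + c > 0 and x + c <= 2 (t + c) on the segment. *)
Lemma measure_segment_low K mu t : 0 <= K ->
  \int[mu]_(x in `[- K, K])
    (step_approx n).[(2 * (t + (K + 2 * `|t| + 1)))^-1 * (x + (K + 2 * `|t| + 1))]
    @[n --> \oo] --> fine (mu (`]-oo, t] `&` `[- K, K])).
Proof.
move=> K0; set c := K + _ + _.
have tc : 0 < t + c.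
  rewrite /c; have := ler_norm (- t); rewrite normrN.
  by have := normr_ge0 t; lra.
pose y x := (2 * (t + c))^-1 * (x + c).
have y01 x : x \in `[- K, K] -> 0 <= y x <= 1.
  rewrite in_itv/= => /andP[xK Kx]; rewrite /y mulrC.
  rewrite divr_ge0 ?ler_pdivrMr ?mul1r ?mulr_gt0//=; last first.
  - by rewrite mulr_ge0// ltW.
  - by rewrite /c; have := normr_ge0 t; lra.
  - rewrite /c; have := ler_norm (- t); rewrite normrN.
    by have := normr_ge0 t; lra.
have -> : fine (mu (`]-oo, t] `&` `[- K, K])) =
    \int[mu]_(x in `[- K, K]) \1_(`]-oo, t]) x.
  by rewrite /Rintegral integral_indic.
apply: (@cvg_Rintegral_dominated _ _ _ mu _ _ _ (cst 1) _ _ _ _ _).2 => //.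
- move=> n; apply: measurable_funTS; apply: continuous_measurable_fun => x.
  apply: (@continuous_comp _ _ _ y (horner (step_approx n)));
    last exact: continuous_horner.
  apply: cvgM; first exact: cvg_cst.
  by apply: cvgD; [exact: cvg_id|exact: cvg_cst].
- exact: finite_measure_integrable_cst.
- move=> n x xD; rewrite -/(y x) ger0_norm ?step_approx_ge0 ?step_approx_le1//;
  exact: y01.
- move=> x xD; rewrite -/(y x); have /andP[y0 y1] := y01 x xD.
  rewrite indicE; have [xt|tx] := leP x t.
    rewrite mem_set/= ?in_itv//=; apply: cvg_step_approx_low; rewrite y0/=.
    by rewrite /y mulrC ler_pdivrMr ?mulr_gt0//; lra.
  rewrite memNset/= ?in_itv/= ?leNgt ?tx//; apply: cvg_step_approx_high.
  by rewrite y1 andbT /y mulrC ltr_pdivlMr ?mulr_gt0//; lra.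
Qed.

Lemma measure_null_setI mu (A D : set R) : measurable A -> measurable D ->
  mu (~` D) = 0%E -> mu (A `&` D) = mu A.
Proof.
move=> mA mD D0; rewrite [RHS](measureDI mu mA mD).
rewrite [X in (X + _)%E](_ : _ = 0%E) ?add0e//.
apply/eqP; rewrite eq_le measure_ge0 andbT -D0.
apply: (le_measure mu); rewrite ?inE;
  [exact: measurableD|exact: measurableC|by move=> x []].
Qed.

Lemma eq_measure_rays (m1 m2 : {measure set (measurableTypeR R) -> \bar R}) :
  (forall x : R, m1 `]x, +oo[%classic = m2 `]x, +oo[%classic) ->
  (forall x : R, (m1 `]x, +oo[%classic < +oo)%E) ->
  forall A : set (measurableTypeR R), measurable A -> m1 A = m2 A.
Proof.
move=> m12 fin A mA.
apply: (@measure_unique _ _ (measurableTypeR R) (@RGenOInfty.G R)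
  (fun n => `](- n%:R), +oo[%classic) _ _ _ _ m1 m2 _ _ A mA).
- exact: RGenOInfty.measurableE.
- move=> _ _ [x ->] [y ->]; exists (Order.max x y).
  by apply/seteqP; split => z /=; rewrite !in_itv/= !andbT gt_max => /andP.
- by move=> n; exists (- n%:R).
- apply/seteqP; split => // x _; exists (Num.bound `|x|) => //=.
  rewrite in_itv/= andbT ltrNl; apply: le_lt_trans (archi_boundP _) => //.
  by rewrite -normrN ler_norm.
- by move=> _ [x ->].
- by move=> n; exact: fin.
Qed.

(** The approximating polynomials converge boundedly to the indicator of a ray, so equal moments
    give equal distribution functions. *)
Lemma eq_prob_moments mu nu K : 0 <= K ->
  mu (~` `[- K, K]) = 0%E -> nu (~` `[- K, K]) = 0%E ->
  (forall n, \int[mu]_(x in `[- K, K]) x ^+ n = \int[nu]_(x in `[- K, K]) x ^+ n) ->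
  forall A : set (measurableTypeR R), measurable A -> mu A = nu A.
Proof.
move=> K0 muK nuK munu.
have low (t : R) : mu `]-oo, t]%classic = nu `]-oo, t]%classic.
  rewrite -(measure_null_setI _ _ muK)// -(measure_null_setI _ _ nuK)//.
  rewrite -[LHS]fineK ?fin_num_measure//; last exact: measurableI.
  rewrite -[RHS]fineK ?fin_num_measure//; last exact: measurableI.
  congr EFin; have := @measure_segment_low K mu t K0.
  rewrite [X in X @ _ --> _ -> _](_ : _ = fun n =>
    \int[nu]_(x in `[- K, K])
      (step_approx n).[(2 * (t + (K + 2 * `|t| + 1)))^-1 * (x + (K + 2 * `|t| + 1))]).
    by move=> h; exact: (cvg_unique _ h (@measure_segment_low K nu t K0)).
  apply/funext => n; set c := K + _ + _; set s := (_ * _)^-1.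
  have := eq_Rintegral_horner munu (step_approx n \Po (s *: ('X + c%:P))).
  rewrite (_ : (fun x => _) = fun x => (step_approx n).[s * (x + c)]) => [->//|].
  by apply/funext => x; rewrite horner_comp hornerZ hornerD hornerX hornerC.
move=> A mA; apply: (eq_measure_rays (m1 := mu) (m2 := nu)) => // [x|x].
- have mI := measurable_itv `]-oo, x] : measurable (`]-oo, x]%classic : set (measurableTypeR R)).
  by rewrite -setCitvl [LHS](probability_setC mu mI) [RHS](probability_setC nu mI) low.
- by apply: le_lt_trans (probability_le1 _ _) _; rewrite ?ltry.
Qed.
End MomentDetermination.

(** * Uniqueness of the measure solving the transform equation *)

Section TransformUnique.
Context {R : realType}.
Implicit Types (mu nu : prob R) (K : R).

Lemma symmetric_Rintegral_odd (mu : {measure set (measurableTypeR R) -> \bar R})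
    (D : set (measurableTypeR R)) (f : measurableTypeR R -> R) :
  symmetric_measure mu -> measurable D -> -%R @^-1` D = D ->
  measurable_fun setT f -> mu.-integrable D (EFin \o f) ->
  (forall x, f (- x) = - f x) -> \int[mu]_(x in D) f x = 0.
Proof.
move=> sym mD DN mf intf fN.
have mN : measurable_fun setT (-%R : measurableTypeR R -> measurableTypeR R).
  exact: oppr_measurable.
have pushE : \int[mu]_(x in D) f x = \int[mu]_(x in D) (- f x).
  rewrite /Rintegral; congr fine.
  transitivity (\int[pushforward mu (-%R : measurableTypeR R -> measurableTypeR R)]_(x in D) (f x)%:E)%E.
    apply: eq_measure_integral => A mA _; rewrite /pushforward/= -(sym A mA).
    congr (mu _); apply/seteqP; split => [x [y Ay <-]/=|x Ax]; first by rewrite opprK.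
    by exists (- x) => //; rewrite opprK.
  rewrite integral_pushforward//= ?DN.
  - by apply: eq_integral => x _; rewrite /= fN.
  - exact/measurable_EFinP.
  - apply: (@eq_integrable _ _ _ mu D mD (fun x => - (EFin \o f) x)%E).
      by move=> x _; rewrite /= fN.
    by rewrite integrableN.
have : \int[mu]_(x in D) (- f x) = - \int[mu]_(x in D) f x.
  under eq_Rintegral do rewrite -mulN1r.
  by rewrite RintegralZl// mulN1r.
by rewrite -pushE; lra.
Qed.

Lemma Rintegral_null_compl mu (D : set (measurableTypeR R)) (f : R -> R) :
  measurable D -> mu (~` D) = 0%E -> mu.-integrable setT (EFin \o f) ->
  \int[mu]_(x in D) f x = \int[mu]_x f x.
Proof.
move=> mD D0 intf; rewrite /Rintegral; congr fine.
rewrite [RHS](@negligible_integral _ _ _ mu setT (~` D))//.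
  by rewrite setTD setCK.
exact: measurableC.
Qed.

Lemma moment_le_pow mu K n : 0 <= K -> mu (~` `[- K, K]) = 0%E ->
  mu.-integrable setT (fun x : measurableTypeR R => (x ^+ n.*2)%:E) ->
  moment mu n.*2 <= K ^+ n.*2.
Proof.
move=> K0 muK int_n; rewrite /moment -(Rintegral_null_compl _ muK)//.
have Dle : mu `[- K, K]%classic = 1%E.
  have mD : measurable (`[- K, K]%classic : set (measurableTypeR R)).
    exact: measurable_itv.
  rewrite -[`[- K, K]%classic]setCK [LHS](probability_setC mu (measurableC mD)).
  by rewrite [X in (_ - X)%E]muK sube0.
apply: (@le_trans _ _ (\int[mu]_(x in `[- K, K]) K ^+ n.*2)); last first.
  by rewrite Rintegral_cst// [X in fine X]Dle mulr1.
apply: le_Rintegral => //.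
- exact: integrableS int_n.
- exact: finite_measure_integrable_cst.
- move=> x /=; rewrite in_itv/= -ler_norml => xK.
  by rewrite -(ger0_norm (expr_double_ge0 x n)) normrX lerXn2r ?nnegrE.
Qed.

Lemma tail_le_moment mu (c : R) n : 0 <= c ->
  mu.-integrable setT (fun x : measurableTypeR R => (x ^+ n.*2)%:E) ->
  c ^+ n.*2 * fine (mu (~` `[- c, c])) <= moment mu n.*2.
Proof.
move=> c0 int_n; have mC : measurable (~` `[- c, c] : set (measurableTypeR R)).
  exact: measurableC.
rewrite -Rintegral_cst// /moment.
apply: (@le_trans _ _ (\int[mu]_(x in ~` `[- c, c]) x ^+ n.*2)).
  apply: le_Rintegral => //.
  - exact: finite_measure_integrable_cst.
  - exact: integrableS int_n.
  - move=> x /=; rewrite in_itv/= -ler_norml => /negP; rewrite -ltNge => cx.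
    by rewrite -[leRHS](ger0_norm (expr_double_ge0 x n)) normrX lerXn2r ?nnegrE// ltW.
rewrite /Rintegral fine_le//.
- by apply: integrable_fin_num => //; exact: integrableS int_n.
- exact: integrable_fin_num.
- apply: ge0_subset_integral => //; last by move=> x _; rewrite lee_fin expr_double_ge0.
  by apply/measurable_EFinP; exact: exprn_measurable.
Qed.

(** Markov's inequality at order [n.*2] bounds the mass outside the segment by (K/c)^(2n), which
    tends to 0. *)
Lemma tail_eq0 nu (K c : R) : 0 <= K -> K < c ->
  (forall n, nu.-integrable setT (fun x : measurableTypeR R => (x ^+ n.*2)%:E)) ->
  (forall n, moment nu n.*2 <= K ^+ n.*2) -> nu (~` `[- c, c]) = 0%E.
Proof.
move=> K0 Kc int_n mK; have c0 : 0 < c by exact: le_lt_trans Kc.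
have mC : measurable (~` `[- c, c] : set (measurableTypeR R)).
  exact: measurableC.
rewrite -[LHS]fineK ?fin_num_measure//; congr EFin.
apply/eqP; rewrite eq_le fine_ge0// andbT.
have qlt : `|(K / c) ^+ 2| < 1.
  have Kc0 : 0 <= K / c by rewrite divr_ge0// ltW.
  by rewrite ger0_norm ?sqr_ge0// expr_lt1// ltr_pdivrMr// mul1r.
apply: (cvgr_to_ge (@cvg_geometric R 1 _ qlt)); apply: nearW => n.
rewrite /= mul1r -exprM mul2n expr_div_n ler_pdivlMr ?exprn_gt0//.
rewrite mulrC; apply: le_trans (mK n).
by apply: tail_le_moment => //; exact: ltW.
Qed.

(** Each sequence serves to derive the recursion for its own measure, so the two may differ. The
    compact support of [mu] passes to [nu] through the common even moments, and symmetry makes the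
    odd ones vanish. *)
Lemma transform_unique (lam : R) mu nu K (u_ v_ : nat -> R) : 0 <= K ->
  symmetric_measure mu -> symmetric_measure nu -> mu (~` `[- K, K]) = 0%E ->
  (forall k, 0 < u_ k) -> u_ k @[k --> \oo] --> (0 : R) ->
  (forall k, 0 < v_ k) -> v_ k @[k --> \oo] --> (0 : R) ->
  (forall k, u_ k * (lam * moment_transform mu 0 (u_ k) ^+ 2 +
     (1 - lam) * moment_transform mu 0 (u_ k)) = 1 - moment_transform mu 0 (u_ k)) ->
  (forall k, v_ k * (lam * moment_transform nu 0 (v_ k) ^+ 2 +
     (1 - lam) * moment_transform nu 0 (v_ k)) = 1 - moment_transform nu 0 (v_ k)) ->
  forall A : set (measurableTypeR R), measurable A -> nu A = mu A.
Proof.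
move=> K0 smu snu muK u0 ucvg v0 vcvg muE nuE.
have imu n := transform_moments_integrable u0 ucvg muE n.
have inu n := transform_moments_integrable v0 vcvg nuE n.
have mE n : moment nu n.*2 = moment mu n.*2.
  exact: (rect_recursion_unique (transform_rect_recursion v0 vcvg nuE)
    (transform_rect_recursion u0 ucvg muE)).
have mK n : moment mu n.*2 <= K ^+ n.*2 by exact: moment_le_pow.
(* [tail_eq0] asks for a segment strictly larger than the one that bounds the moments. *)
have KS : K < K + 1 by lra.
have nuK1 : nu (~` `[- (K + 1), K + 1]) = 0%E.
  by apply: (@tail_eq0 _ K) => // n; rewrite mE.
have muK1 : mu (~` `[- (K + 1), K + 1]) = 0%E.
  exact: (@tail_eq0 _ K).
apply: (@eq_prob_moments _ _ _ (K + 1)) => //; first by lra.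
move=> n; have [on|en] := boolP (odd n); last first.
  have nE : n./2.*2 = n by lia.
  have iE (m : prob R) :
      (forall k, m.-integrable setT (fun x : measurableTypeR R => (x ^+ k.*2)%:E)) ->
      m.-integrable setT (fun x : measurableTypeR R => (x ^+ n)%:E).
    by move=> /(_ n./2); rewrite nE.
  rewrite (Rintegral_null_compl _ nuK1 (iE _ inu))//.
  rewrite (Rintegral_null_compl _ muK1 (iE _ imu))//.
  by have := mE n./2; rewrite nE.
have DN : -%R @^-1` `[- (K + 1), K + 1]%classic = `[- (K + 1), K + 1]%classic.
  by apply/seteqP; split => x /=; rewrite !in_itv/= lerN2 lerNl andbC.
rewrite !(@symmetric_Rintegral_odd _ `[- (K + 1), K + 1]%classic)//.
- by apply: integrable_continuous_segment; exact: exprn_continuous.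
- by move=> x; rewrite exprNn -signr_odd on expr1 mulN1r.
- by apply: integrable_continuous_segment; exact: exprn_continuous.
- by move=> x; rewrite exprNn -signr_odd on expr1 mulN1r.
Qed.
End TransformUnique.

(** * The R-transform on the negative axis *)

Section RtransformInversion.
Context {R : realType}.
Local Open Scope complex_scope.
Implicit Types (nu : prob R) (lam r u t : R).

(** This is -h(-r): solving C(z) = z for h gives z / h(z) = (1 + z)(1 + lam z). *)
Definition rect_arg lam r := r / ((1 - r) * (1 - lam * r)).

Lemma rect_arg_gt0 lam r : lam <= 1 -> 0 < r -> r < 1 -> 0 < rect_arg lam r.
Proof.
move=> l1 r0 r1; rewrite divr_gt0// mulr_gt0//; first by lra.
by have : lam * r <= r; [rewrite ger_pMl|lra].
Qed.

Lemma rect_argE lam r : lam <= 1 -> 0 < r -> r < 1 ->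
  rect_arg lam r * (lam * (1 - r) ^+ 2 + (1 - lam) * (1 - r)) = r.
Proof.
move=> l1 r0 r1; have l2 : lam * r <= r by rewrite ger_pMl.
by rewrite /rect_arg; field; apply/andP; split; lra.
Qed.

Lemma carg_neg r : 0 < r -> carg (- r%:C) = pi.
Proof.
move=> r0; rewrite /carg normrN normc_def /= oppr0 lexx expr0n addr0 sqrtr_sqr.
by rewrite gtr0_norm// mulNr divff ?gt_eqF// acosN1.
Qed.

Lemma Delta_neg (alpha beta r : R) : 0 < alpha -> 0 < r -> r < beta ->
  Delta alpha beta (- r%:C).
Proof.
move=> a0 r0 rb; split; first split.
- by rewrite oppr_eq0; apply/eqP => -[/eqP]; rewrite gt_eqF.
- by rewrite carg_neg// subrr normr0.
- by rewrite normrN normc_def /= expr0n addr0 sqrtr_sqr gtr0_norm// ltcR.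
Qed.

(** U(w) is a root z of lam z^2 + (lam + 1) z = w, and adding 1 makes the left side factor. Squaring
    removes the dependence on the branch of the root. *)
Lemma Ufun_inv lam (w z : R[i]) : Ufun lam w = z ->
  w + 1 = (1 + z) * (1 + lam%:C * z).
Proof.
rewrite /Ufun; have [->|l0] := eqVneq lam 0.
  by move=> ->; rewrite mul0r addr0 mulr1 addrC.
set s := sqrtc _ => sz.
have s2 : s ^+ 2 = (lam%:C + 1) ^+ 2 + 4 * lam%:C * w by exact: sqr_sqrtc.
have lC : lam%:C != 0 :> R[i] by apply/eqP => -[/eqP]; rewrite (negbTE l0).
have sE : s = 2 * lam%:C * z + lam%:C + 1 by rewrite -sz; field.
have l4 : 4 * lam%:C != 0 :> R[i] by rewrite mulf_neq0// pnatr_eq0.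
apply: (mulfI l4); move: s2; rewrite sE => s2.
rewrite mulrDr mulr1; apply: (addrI ((lam%:C + 1) ^+ 2)).
by rewrite addrA -s2; ring.
Qed.

Lemma cauchy_kernel_imag (v t : R) : 0 < v ->
  ((0 +i* v)^-1 - t%:C)^-1 =
  (- v ^+ 2 * (t / (1 + v ^+ 2 * t ^+ 2))) +i* (v * (1 / (1 + v ^+ 2 * t ^+ 2))).
Proof.
move=> v0; have D0 : 1 + v ^+ 2 * t ^+ 2 != 0.
  by rewrite gt_eqF// denom_gt0// sqr_ge0.
have vn : v != 0 by rewrite gt_eqF.
have -> : (0 +i* v)^-1 - t%:C = (- t) +i* (- v^-1).
  by apply/eqP; rewrite eq_complex /=; apply/andP; split; apply/eqP; field.
transitivity ((- t / ((- t) ^+ 2 + (- v^-1) ^+ 2)) +i*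
  (- (- v^-1 / ((- t) ^+ 2 + (- v^-1) ^+ 2)))); first by [].
by congr Complex; field; rewrite exprMn D0 vn.
Qed.

Lemma integrable_odd_kernel nu u : 0 < u ->
  nu.-integrable setT (EFin \o (fun t : measurableTypeR R => t / (1 + u * t ^+ 2))).
Proof.
move=> u0; pose c := 1 + u^-1.
apply: (@le_integrable _ _ _ nu setT measurableT _ (EFin \o cst c)).
- apply/measurable_EFinP; apply: measurable_funM => //.
  apply: continuous_measurable_fun => x.
  apply: cvgV; first by rewrite gt_eqF// denom_gt0// ltW.
  apply: cvgD; first exact: cvg_cst.
  by apply: cvgM; [exact: cvg_cst|exact: exprn_continuous].
- move=> t _ /=; rewrite lee_fin; have D0 := denom_gt0 t (ltW u0).
  have iu0 : 0 < u^-1 by rewrite invr_gt0.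
  rewrite normrM normfV (gtr0_norm D0) ler_pdivrMr// [`|c|]gtr0_norm ?addr_gt0//.
  rewrite (_ : c * (1 + u * t ^+ 2) = 1 + t ^+ 2 + u * t ^+ 2 + u^-1); last first.
    by rewrite /c; field; rewrite gt_eqF.
  have := sqr_ge0 (`|t| - 1); rewrite sqrrB real_normK ?num_real// expr1n mulr1.
  have : 0 <= u * t ^+ 2 by rewrite mulr_ge0 ?sqr_ge0// ltW.
  by have := normr_ge0 t; lra.
- exact: finite_measure_integrable_cst.
Qed.

(** At an imaginary point the real part of the kernel is odd in t, hence integrates to 0 by
    symmetry. *)
Lemma cauchy_transform_imag nu (v : R) : symmetric_measure nu -> 0 < v ->
  cauchy_transform nu (0 +i* v)^-1 = 0 +i* (v * moment_transform nu 0 (v ^+ 2)).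
Proof.
move=> snu v0; rewrite /cauchy_transform /cintegral.
have v20 : 0 < v ^+ 2 by rewrite exprn_gt0.
congr Complex; under eq_Rintegral do rewrite cauchy_kernel_imag//=.
- have int := integrable_odd_kernel nu v20.
  rewrite RintegralZl//= (symmetric_Rintegral_odd snu _ _ _ int)//; first by rewrite mulr0.
  + by have /integrableP[/measurable_EFinP] := int.
  + by move=> x; rewrite sqrrN mulNr.
- rewrite RintegralZl//.
  exact: (@integrable_moment_transform _ nu 0 _ (ltW v20) (integrable_moment0 nu)).
Qed.

Lemma Rtransform_id_moment_transform lam nu (C : R[i] -> R[i]) :
  0 <= lam -> lam <= 1 -> symmetric_measure nu -> is_Rtransform lam nu C ->
  (forall r, 0 < r -> C (- r%:C) = - r%:C) ->
  exists2 e, 0 < e & forall r, 0 < r -> r < e ->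
    r < 1 /\ moment_transform nu 0 (rect_arg lam r) = 1 - r.
Proof.
move=> l0 l1 snu [h [_ _ hH] hC] Cr.
(* Any opening angle would do, since -r has argument pi. *)
have pi2 : 0 < pi / 2 :> R by rewrite divr_gt0// pi_gt0.
have pi2' : pi / 2 < pi :> R by have := pi_gt0 R; lra.
have [b1 b10 H1] := hH _ pi2 pi2'.
have [b2 b20 H2] := hC _ pi2 pi2'.
exists (Num.min 1 (Num.min b1 b2)); first by rewrite !lt_min ltr01 b10.
move=> r r0; rewrite !lt_min => /and3P[r1 rb1 rb2]; split=> //.
have [_ Hh _] := H1 _ (Delta_neg pi2 r0 rb1).
have := H2 _ (Delta_neg pi2 r0 rb2); rewrite Cr// => /esym/Ufun_inv.
rewrite subrK => hE.
have lr : lam * r <= r by rewrite ger_pMl.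
set u := rect_arg lam r; have u0 : 0 < u by exact: rect_arg_gt0.
have hrE : h (- r%:C) = - u%:C.
  have E : (1 - r%:C) * (1 + lam%:C * - r%:C) = ((1 - r) * (1 - lam * r))%:C.
    by rewrite mulrN -!rmorphM -!rmorphB -rmorphM.
  have p0 : (1 - r) * (1 - lam * r) != 0 by rewrite mulf_neq0//; apply: lt0r_neq0; lra.
  have p0C : ((1 - r) * (1 - lam * r))%:C != 0 :> R[i].
    by apply/eqP => -[/eqP]; rewrite (negbTE p0).
  move: hE; rewrite E => hE.
  (* Division by 0 yields 0, so a zero of [h] here would contradict the nonzero value of the
     quotient. *)
  have h0 : h (- r%:C) != 0.
    by apply: contra_neq p0C => h0; rewrite -hE h0 invr0 mulr0.
  have -> : u%:C = r%:C / ((1 - r) * (1 - lam * r))%:C by rewrite -fmorph_div.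
  by rewrite -mulNr -hE; field; rewrite h0; apply/eqP => -[/eqP]; rewrite gt_eqF.
move: Hh; rewrite hrE /Hfun.
have sE : sqrt_up (- u%:C) = 0 +i* Num.sqrt u.
  rewrite /sqrt_up opprK sqrtc_sqrtr ?ler0c ?ltW//=.
  by simpc.
have su0 : 0 < Num.sqrt u by rewrite sqrtr_gt0.
rewrite sE cauchy_transform_imag// sqr_sqrtr ?ltW//.
set F := moment_transform nu 0 u; set v := Num.sqrt u.
have v2 : v * v = u by rewrite -expr2 sqr_sqrtr// ltW.
move=> [HE _].
have HE' : u * (lam * F ^+ 2 + (1 - lam) * F) = r.
  by rewrite -[RHS]opprK -HE -v2; ring.
have F0 : 0 <= F.
  apply: Rintegral_ge0 => x _; rewrite divr_ge0// ?expr_double_ge0//.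
  by apply/ltW/denom_gt0/ltW.
have := rect_argE l1 r0 r1; rewrite -/u => E2.
(* Both [F] and [1 - r] solve the same equation; the cofactor of their difference is positive
   because [F] is nonnegative, which selects the root. *)
have : (F - (1 - r)) * (u * (lam * (F + (1 - r)) + (1 - lam))) = 0.
  transitivity (u * (lam * F ^+ 2 + (1 - lam) * F) -
      u * (lam * (1 - r) ^+ 2 + (1 - lam) * (1 - r))).
    by ring.
  by rewrite HE' E2 subrr.
move=> /eqP; rewrite mulf_eq0 => /orP[/eqP|]; first by lra.
rewrite mulf_eq0 gt_eqF//= gt_eqF//.
move: l0; rewrite le_eqVlt => /orP[/eqP <-|l0]; first by rewrite mul0r; lra.
by rewrite ltr_pwDl ?subr_ge0// mulr_gt0//; lra.
Qed.

Lemma rect_arg_sequence lam (F : R -> R) e : lam <= 1 -> 0 < e ->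
  (forall r, 0 < r -> r < e -> r < 1 /\ F (rect_arg lam r) = 1 - r) ->
  exists u_ : nat -> R, [/\ forall k, 0 < u_ k, u_ k @[k --> \oo] --> (0 : R)
    & forall k, u_ k * (lam * F (u_ k) ^+ 2 + (1 - lam) * F (u_ k)) = 1 - F (u_ k)].
Proof.
move=> l1 e0 HF; pose r k := e / 2 * harmonic k.
have r0 k : 0 < r k by rewrite mulr_gt0 ?harmonic_gt0// divr_gt0.
have re k : r k < e.
  apply: (@le_lt_trans _ _ (e / 2)); last by lra.
  rewrite /r ler_piMr//; first by rewrite divr_ge0// ltW.
  by rewrite invf_le1// ler1n.
have rcvg : r k @[k --> \oo] --> (0 : R).
  rewrite -(mulr0 (e / 2)); apply: cvgM; first exact: cvg_cst.
  exact: cvg_harmonic.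
exists (fun k => rect_arg lam (r k)); split=> [k||k].
- by have [r1 _] := HF _ (r0 k) (re k); exact: rect_arg_gt0.
- rewrite -[X in _ --> X](mul0r ((1 - 0) * (1 - lam * 0))^-1).
  apply: cvgM => //; apply: cvgV.
    by rewrite mulr0 !subr0 mulr1 oner_eq0.
  apply: cvgM; apply: cvgB; [exact: cvg_cst|by []|exact: cvg_cst|].
  by apply: cvgM; [exact: cvg_cst|].
- have [r1 FE] := HF _ (r0 k) (re k).
  by rewrite FE rect_argE//; ring.
Qed.
End RtransformInversion.

(** * Integration against a density *)

Section Density.
Context {R : realType}.
Implicit Types (m : prob R) (f g : R -> R).

Lemma has_density_dominates m f : measurable_fun setT f -> has_density m f ->
  m `<< (@lebesgue_measure R).
Proof.
move=> mf md; apply/null_content_dominatesP => A mA A0; rewrite (md A mA).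
by apply: null_set_integral => //; apply/measurable_EFinP; exact: measurable_funTS.
Qed.

(** The density agrees almost everywhere with the Radon-Nikodym derivative, to which the change of
    variables formula applies. *)
Lemma integral_has_density m f g (U : set (measurableTypeR R)) :
  measurable_fun setT f -> has_density m f -> measurable U ->
  m.-integrable U (EFin \o g) ->
  \int[m]_(x in U) g x = \int[lebesgue_measure]_(x in U) (g x * f x).
Proof.
move=> mf md mU ig; have dom := has_density_dominates mf md.
rewrite /Rintegral; congr fine.
rewrite -(Radon_Nikodym_change_of_variables dom mU ig).
apply: ae_eq_integral => //.
- apply: emeasurable_funM; first exact: measurable_int ig.
  apply: (measurable_int lebesgue_measure).
  apply: (integrableS _ _ (@subsetT _ _)) => //=.
  by apply: Radon_Nikodym_integrable.
- apply/measurable_EFinP; apply: measurable_funM; last exact: measurable_funTS.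
  by have /integrableP[/measurable_EFinP] := ig.
- under [X in ae_eq _ _ _ X]eq_fun do rewrite EFinM.
  apply: ae_eqe_mul2l => /=.
  rewrite Radon_NikodymE//=; case: cid => /= h [h1 h2 h3].
  apply: integral_ae_eq => //=.
  + exact: integrableS h2.
  + by apply/measurable_EFinP; exact: measurable_funTS.
  + by move=> E EU mE; rewrite -h3//= -md.
Qed.
End Density.

(** * Antiderivatives and integrals over growing segments *)

Section Calculus.
Context {R : realType}.
Implicit Types (F f : R -> R) (a b : R).

Lemma Rintegral_is_derive F f a b : a < b ->
  (forall x : R, is_derive x 1 F (f x)) ->
  continuous f -> \int[lebesgue_measure]_(x in `[a, b]) f x = F b - F a.
Proof.
move=> ab dF cf; have cF : continuous F.
  by move=> x; apply: differentiable_continuous; apply/derivable1_diffP; case: (dF x).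
rewrite /Rintegral (@continuous_FTC2 _ f F)//.
- exact: continuous_subspaceT.
- split; first by move=> x _; case: (dF x).
  + by apply: cvg_at_right_filter; exact: cF.
  + by apply: cvg_at_left_filter; exact: cF.
- by move=> x _; rewrite derive1E; have dFx := dF x; exact: derive_val.
Qed.

Lemma cvg_Rintegral_segment f : lebesgue_measure.-integrable setT (EFin \o f) ->
  \int[lebesgue_measure]_(x in `[- n%:R, n%:R]) f x @[n --> \oo] -->
  \int[lebesgue_measure]_x f x.
Proof.
move=> intf; have mf : measurable_fun setT f.
  by have /integrableP[/measurable_EFinP] := intf.
under eq_fun do rewrite Rintegral_mkcond.
apply: (@cvg_Rintegral_dominated _ _ _ lebesgue_measure setT _ _ (fun x => `|f x|) _ _ _ _ _).2 => //.
- by move=> n; apply/(measurable_restrictT _ _).1 => //; exact: measurable_funTS.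
- exact: integrable_norm.
- by move=> n x _; rewrite patchE; case: ifP => //; rewrite normr0.
- move=> x _; apply: cvg_near_cst; near=> n.
  rewrite patchE mem_set//= in_itv/= -ler_norml.
  near: n; exact: nbhs_infty_ger.
Unshelve. all: by end_near.
Qed.
End Calculus.

(** * Characteristic function of the standard Gaussian *)

Section GaussianCosineTransform.
Context {R : realType}.
Implicit Types (x t xi : R).
Notation pdf := (@normal_pdf R 0 1).
Notation mu := (@lebesgue_measure R).

Lemma std_normal_pdfE x : pdf x = normal_peak 1 * expR (- (x ^+ 2 / 2)).
Proof. by rewrite normal_pdfE// /normal_fun subr0 expr1n mulNr. Qed.

Lemma is_derive_std_normal_pdf x : is_derive x 1 pdf (- x * pdf x).
Proof.
have -> : pdf = (fun x => normal_peak 1 * expR (- (x ^+ 2 / 2))).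
  by apply/funext => y; rewrite std_normal_pdfE.
by apply: is_derive_eq; rewrite /GRing.scale/=; field.
Qed.

(** From exp(n^2/2) >= 1 + n^2/2 >= (n + 1)/2. The hypothesis on squares covers both n and -n. *)
Lemma std_normal_pdf_decay (n : nat) x : x ^+ 2 = n%:R ^+ 2 ->
  pdf x <= 2 * normal_peak 1 * harmonic n.
Proof.
move=> xn; rewrite std_normal_pdfE xn.
have -> : 2 * normal_peak 1 * harmonic n = normal_peak 1 * (2 * harmonic n) :> R.
  by ring.
have k1 : 0 < normal_peak (1 : R) by exact: normal_peak_gt0.
apply: ler_wpM2l; first exact: ltW.
have -> : 2 * harmonic n = (n.+1%:R / 2)^-1 :> R by rewrite /harmonic invf_div.
rewrite expRN lef_pV2 ?posrE ?expR_gt0// ?divr_gt0//.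
apply: le_trans (expR_ge1Dx _); rewrite -natr1.
have := sqr_ge0 (n%:R - 2^-1 : R); rewrite sqrrB expr2; nra.
Qed.

Lemma integrable_norm_std_normal :
  mu.-integrable setT (EFin \o (fun x => `|x| * pdf x)).
Proof.
(* Comparison with the Gaussian of standard deviation 2: x^2/2 = x^2/8 + 3x^2/8 and |x| exp(-3x^2/8)
   <= 8/3; the two peaks correct the normalisations. *)
pose C : R := 8 / 3 * normal_peak 1 / normal_peak 2.
have k2 : 0 < normal_peak (2 : R) by exact: normal_peak_gt0.
have k1 : 0 < normal_peak (1 : R) by exact: normal_peak_gt0.
have C0 : 0 < C.
  by apply: divr_gt0 => //; apply: mulr_gt0 => //; apply: divr_gt0.
apply: (@le_integrable _ _ _ mu setT measurableT _ (fun x => C%:E * (normal_pdf 0 2 x)%:E)%E).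
- apply/measurable_EFinP; apply: measurable_funM => //.
  exact: measurable_normal_pdf.
- move=> x _ /=; rewrite lee_fin normrM normr_id [`|pdf x|]ger0_norm ?normal_pdf_ge0//.
  rewrite [leRHS]ger0_norm; last first.
    by rewrite mulr_ge0 ?normal_pdf_ge0// ltW.
  rewrite std_normal_pdfE normal_pdfE// /normal_fun subr0.
  have -> : C * (normal_peak 2 * expR (- x ^+ 2 / (2 ^+ 2 *+ 2))) =
      normal_peak 1 * (8 / 3 * expR (- x ^+ 2 / (2 ^+ 2 *+ 2))).
    by rewrite /C; field; rewrite gt_eqF.
  rewrite mulrCA ler_pM2l//.
  have -> : - (x ^+ 2 / 2) = - x ^+ 2 / (2 ^+ 2 *+ 2) + - (3 / 8 * x ^+ 2) by field.
  rewrite expRD [expR (- (3 / 8 * _))]expRN mulrCA [leRHS]mulrC ler_pM2l ?expR_gt0//.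
  rewrite ler_pdivrMr ?expR_gt0//.
  apply: (@le_trans _ _ (8 / 3 * (1 + 3 / 8 * x ^+ 2))).
    have := sqr_ge0 (`|x| - 1); rewrite sqrrB real_normK ?num_real// expr1n mulr1.
    by have := sqr_ge0 x; lra.
  by rewrite ler_pM2l//; exact: expR_ge1Dx.
- by apply: integrableZl => //; exact: integrable_normal_pdf.
Qed.

Lemma integrable_dominated_std_normal (g h : R -> R) :
  mu.-integrable setT (EFin \o (fun x => h x * pdf x)) ->
  measurable_fun setT g -> (forall x, `|g x| <= h x) ->
  mu.-integrable setT (EFin \o (fun x => g x * pdf x)).
Proof.
move=> ih mg gh; apply: (@le_integrable _ _ _ mu setT measurableT _ 
  (EFin \o (fun x => h x * pdf x))) => //.
- apply/measurable_EFinP; apply: measurable_funM => //.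
  exact: measurable_normal_pdf.
- move=> x _ /=; rewrite lee_fin !normrM ler_wpM2r//.
  by rewrite (le_trans (gh x))// ler_norm.
Qed.

Lemma continuous_cosM xi : continuous (fun t => cos (t * xi)).
Proof.
move=> t; apply: (@continuous_comp _ _ _ (fun t => t * xi) cos).
  by apply: cvgM; [exact: cvg_id|exact: cvg_cst].
exact: continuous_cos.
Qed.

Lemma continuous_sinM xi : continuous (fun t => sin (t * xi)).
Proof.
move=> t; apply: (@continuous_comp _ _ _ (fun t => t * xi) sin).
  by apply: cvgM; [exact: cvg_id|exact: cvg_cst].
exact: continuous_sin.
Qed.

Lemma integrable_cos_std_normal xi :
  mu.-integrable setT (EFin \o (fun t => cos (t * xi) * pdf t)).
Proof.
apply: (@integrable_dominated_std_normal _ (cst 1)).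
- apply: (@eq_integrable _ _ _ mu _ measurableT (EFin \o pdf)).
    by move=> x _ /=; rewrite mul1r.
  exact: integrable_normal_pdf.
- by apply: continuous_measurable_fun; exact: continuous_cosM.
- by move=> x; rewrite ler_norml cos_geN1 cos_le1.
Qed.

Lemma integrable_sin_std_normal xi :
  mu.-integrable setT (EFin \o (fun t => t * sin (t * xi) * pdf t)).
Proof.
apply: (@integrable_dominated_std_normal _ (fun t => `|t|)).
- exact: integrable_norm_std_normal.
- apply: measurable_funM => //.
  by apply: continuous_measurable_fun; exact: continuous_sinM.
- by move=> x; rewrite normrM ler_piMr// ler_norml sin_geN1 sin_le1.
Qed.

Definition std_normal_cos xi : R := \int[mu]_t (cos (t * xi) * pdf t).

(** Integration by parts: the difference of the two integrands is the derivative of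
    [sin (t * xi) * pdf t], which vanishes at infinity. *)
Lemma std_normal_sinE xi :
  \int[mu]_t (t * sin (t * xi) * pdf t) = xi * std_normal_cos xi.
Proof.
pose F t := sin (t * xi) * pdf t.
pose f t := xi * (cos (t * xi) * pdf t) - t * sin (t * xi) * pdf t.
have icos : mu.-integrable setT (EFin \o (fun t => xi * (cos (t * xi) * pdf t))).
  exact: (integrableZl measurableT xi (integrable_cos_std_normal xi)).
have isin := integrable_sin_std_normal xi.
have intf : mu.-integrable setT (EFin \o f).
  exact: (integrableB measurableT icos isin).
have dF t : is_derive t 1 F (f t).
  have dp := is_derive_std_normal_pdf t.
  apply: is_derive_eq; rewrite /GRing.scale/= /f; ring.
have cpdf : continuous pdf by apply: continuous_normal_pdf; exact: oner_neq0.
have cf : continuous f.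
  move=> t; apply: cvgB.
    apply: cvgM; first exact: cvg_cst.
    by apply: cvgM; [exact: continuous_cosM|exact: cpdf].
  by apply: cvgM; [apply: cvgM; [exact: cvg_id|exact: continuous_sinM]|exact: cpdf].
have cvg0 : \int[mu]_(x in `[- n.+1%:R, n.+1%:R]) f x @[n --> \oo] --> (0 : R).
  apply: norm_cvg0.
  apply: (@squeeze_cvgr _ _ _ _ (cst 0) (fun n => 4 * normal_peak 1 * harmonic n.+1)).
  - apply: nearW => n; rewrite normr_ge0/= (Rintegral_is_derive _ dF cf); last first.
      by have : 0 < n.+1%:R :> R by []; lra.
    have bF t : t ^+ 2 = n.+1%:R ^+ 2 -> `|F t| <= 2 * normal_peak 1 * harmonic n.+1.
      move=> tn; rewrite /F normrM; apply: le_trans (std_normal_pdf_decay tn).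
      rewrite [`|pdf t|]ger0_norm ?normal_pdf_ge0// ler_piMl ?normal_pdf_ge0//.
      by rewrite ler_norml sin_geN1 sin_le1.
    apply: le_trans (ler_normB _ _) _.
    have -> : 4 * normal_peak 1 * harmonic n.+1 =
        2 * normal_peak 1 * harmonic n.+1 + 2 * normal_peak 1 * harmonic n.+1 :> R.
      by ring.
    by apply: lerD; apply: bF; rewrite ?sqrrN.
  - exact: cvg_cst.
  - rewrite -(mulr0 (4 * normal_peak 1)); apply: cvgM; first exact: cvg_cst.
    by rewrite cvg_shiftS; exact: cvg_harmonic.
have int0 : \int[mu]_x f x = 0.
  have := cvg_Rintegral_segment intf; rewrite -cvg_shiftS => h.
  exact: (cvg_unique _ h cvg0).
move: int0; rewrite /f RintegralB// RintegralZl//; last exact: integrable_cos_std_normal.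
by rewrite -/(std_normal_cos xi); lra.
Qed.

(** Differentiation under the integral sign, dominated by |t| times the density, followed by the
    integration by parts, yields a linear differential equation for the transform. *)
Lemma is_derive_std_normal_cos xi :
  is_derive xi 1 std_normal_cos (- (xi * std_normal_cos xi)).
Proof.
pose f xi t := cos (t * xi) * pdf t.
have dE x t : is_derive x 1 (f^~ t) (- (t * sin (t * x) * pdf t)).
  by apply: is_derive_eq; rewrite /GRing.scale/=; ring.
have d1E x t : partial1of2 f x t = - (t * sin (t * x) * pdf t).
  by rewrite partial1of2E; exact: (@derive_val _ _ _ _ _ _ _ (dE x t)).
have xiI : `]xi - 1, xi + 1[%classic xi by rewrite /= in_itv/=; lra.
have int_f x : `]xi - 1, xi + 1[%classic x -> mu.-integrable setT (EFin \o f x).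
  by move=> _; exact: integrable_cos_std_normal.
have der_f x t : `]xi - 1, xi + 1[%classic x -> setT t -> derivable (f^~ t) x 1.
  by move=> _ _; case: (dE x t).
have G0 (t : R) : 0 <= `|t| * pdf t by rewrite mulr_ge0// normal_pdf_ge0.
have bd x t : `]xi - 1, xi + 1[%classic x -> setT t -> `|partial1of2 f x t| <= `|t| * pdf t.
  move=> _ _; rewrite d1E normrN !normrM [`|pdf t|]ger0_norm ?normal_pdf_ge0//.
  rewrite ler_wpM2r ?normal_pdf_ge0// ler_piMr//.
  by rewrite ler_norml sin_geN1 sin_le1.
apply: DeriveDef.
  exact: (derivable_under_integral measurableT xiI int_f der_f G0
    integrable_norm_std_normal bd).
rewrite -derive1E (differentiation_under_integral measurableT xiI int_f der_f G0
    integrable_norm_std_normal bd).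
under eq_Rintegral do rewrite d1E -mulN1r.
rewrite RintegralZl//; last exact: integrable_sin_std_normal.
by rewrite mulN1r std_normal_sinE.
Qed.

Lemma std_normal_cosE xi : std_normal_cos xi = expR (- (xi ^+ 2 / 2)).
Proof.
pose D xi := std_normal_cos xi * expR (xi ^+ 2 / 2).
have dD x : is_derive x 1 D 0.
  have dc := is_derive_std_normal_cos x.
  by apply: is_derive_eq; rewrite /GRing.scale/=; field.
have := is_derive_0_is_cst xi 0 dD; rewrite /D expr0n/= mul0r expR0 mulr1 => DE.
apply: (mulIf (lt0r_neq0 (expR_gt0 (xi ^+ 2 / 2)))).
rewrite DE -expRD addNr expR0 /std_normal_cos.
under eq_Rintegral do rewrite mulr0 cos0 mul1r.
by rewrite /Rintegral integral_normal_pdf.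
Qed.

Lemma normal_prob_cos xi : \int[normal_prob 0 1]_t cos (t * xi) = expR (- (xi ^+ 2 / 2)).
Proof.
rewrite -std_normal_cosE (@integral_has_density _ (normal_prob 0 1) pdf)//.
- exact: measurable_normal_pdf.
- apply: measurable_bounded_integrable => //.
  + by apply: le_lt_trans (probability_le1 _ _) _; rewrite ?ltry.
  + by apply: continuous_measurable_fun; exact: continuous_cosM.
  + exists 1; split; first exact: num_real.
    move=> x x1 t _; apply: le_trans (ltW x1).
    by rewrite ler_norml cos_geN1 cos_le1.
Qed.
End GaussianCosineTransform.

(** * The Levy measure of the standard Gaussian *)

Section LevyDirac.
Context {R : realType}.
Implicit Types (G : finmeas R) (t xi : R).

Lemma norm_sin_le t : `|sin t| <= `|t|.
Proof.
wlog t0 : t / 0 < t => [H|].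
  have [t0|t0|->] := ltgtP t 0; last by rewrite sin0.
  - by have := H (- t); rewrite sinN !normrN oppr_gt0; exact.
  - exact: H.
have dsin x : x \in `]0, t[ -> is_derive x 1 sin (cos x) by move=> _; exact: _.
have csin : {within `[0, t], continuous (@sin R)}.
  by apply: continuous_subspaceT; exact: continuous_sin.
have [c _] := MVT t0 dsin csin.
rewrite sin0 !subr0 => ->; rewrite normrM ler_piMl//.
by rewrite ler_norml cos_geN1 cos_le1.
Qed.

Lemma onem_cosE t : 1 - cos t = 2 * sin (t / 2) ^+ 2.
Proof.
have {1}-> : t = t / 2 + t / 2 by field.
by rewrite cosD -!expr2 cos2sin2; ring.
Qed.

Lemma onem_cos_le t : 1 - cos t <= t ^+ 2 / 2.
Proof.
rewrite onem_cosE.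
have : `|sin (t / 2)| ^+ 2 <= `|t / 2| ^+ 2 by rewrite lerXn2r ?nnegrE// norm_sin_le.
by rewrite !real_normK ?num_real// expr_div_n; lra.
Qed.

Lemma cos_eq1_small t : `|t| < 1 -> cos t = 1 -> t = 0.
Proof.
wlog t0 : t / 0 < t => [H|].
  have [t0|t0|->//] := ltgtP t 0; last exact: H.
  move=> t1 ct; apply: oppr_inj; rewrite oppr0.
  by apply: H; rewrite ?oppr_gt0 ?normrN ?cosN.
move=> t1 ct; have : 0 < sin (t / 2).
  apply: sin_gt0_pi; rewrite divr_gt0//=.
  by rewrite gtr0_norm in t1 => //; have := pi_ge2 R; lra.
have := onem_cosE t; rewrite ct subrr => /esym/eqP.
by rewrite mulf_eq0 pnatr_eq0/= sqrf_eq0 => /eqP ->; rewrite ltxx.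
Qed.

Lemma levy_kernel_le0 xi t : levy_kernel xi t <= 0.
Proof.
rewrite /levy_kernel; case: ifP => _.
  by rewrite oppr_le0 divr_ge0// sqr_ge0.
rewrite mulr_le0_ge0 ?subr_le0 ?cos_le1// divr_ge0 ?sqr_ge0//.
by rewrite addr_ge0 ?sqr_ge0.
Qed.

(** In (1 + t^2)/t^2 = 1/t^2 + 1 the first term is controlled by 1 - cos y <= y^2/2 and the second
    by 1 - cos y <= 2. *)
Lemma levy_kernel_bound xi t : `|levy_kernel xi t| <= xi ^+ 2 / 2 + 2.
Proof.
rewrite ler0_norm ?levy_kernel_le0// /levy_kernel; case: ifP => [_|/negbT t0].
  by rewrite opprK lerDl.
have t20 : 0 < t ^+ 2 by rewrite exprn_even_gt0.
rewrite -mulNr opprB mulrA ler_pdivrMr// mulrDr mulr1 mulrDl.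
have := onem_cos_le (t * xi); rewrite exprMn.
have : (1 - cos (t * xi)) * t ^+ 2 <= 2 * t ^+ 2.
  by rewrite ler_pM2r//; have := cos_geN1 (t * xi); lra.
by lra.
Qed.

Lemma measurable_levy_kernel xi : measurable_fun setT (levy_kernel xi).
Proof.
apply: measurable_fun_ifT => //.
- by apply: measurable_fun_eqr; [exact: measurable_id|exact: measurable_cst].
- apply: measurable_funM.
    apply: measurable_funB => //.
    by apply: continuous_measurable_fun; exact: continuous_cosM.
  apply: measurable_funM; first exact: measurable_funD.
  under eq_fun do rewrite -powR_inv1 ?sqr_ge0//.
  exact: (measurableT_comp (measurable_powR _)).
Qed.

Lemma integrable_levy_kernel G xi (D : set (measurableTypeR R)) : measurable D ->
  G.-integrable D (EFin \o levy_kernel xi).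
Proof.
move=> mD; apply: (@le_integrable _ _ _ G D mD _ (EFin \o cst (xi ^+ 2 / 2 + 2))).
- by apply/measurable_EFinP; apply: measurable_funTS; exact: measurable_levy_kernel.
- move=> t _ /=; rewrite lee_fin [leRHS]ger0_norm; first exact: levy_kernel_bound.
  by rewrite addr_ge0// divr_ge0// sqr_ge0.
- exact: finite_measure_integrable_cst.
Qed.

(** At t = 0 the kernel is quadratic in the frequency and elsewhere it is bounded in it, so division
    by the squared frequency isolates the atom at 0. *)
Lemma cvg_levy_kernel t :
  levy_kernel n.+1%:R t / n.+1%:R ^+ 2 @[n --> \oo] -->
  (- 2^-1 * \1_[set (0 : R)] t : R).
Proof.
have n0 (n : nat) : (n.+1%:R : R) != 0 by rewrite pnatr_eq0.
rewrite indicE; have [->|t0] := eqVneq t 0.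
  rewrite mem_set// mulr1; apply: cvg_near_cst; apply: nearW => n.
  by rewrite /levy_kernel eqxx; field.
rewrite memNset//=; last by move=> /eqP; rewrite (negbTE t0).
rewrite mulr0; set c := (1 + t ^+ 2) / t ^+ 2.
have c0 : 0 <= c by rewrite divr_ge0 ?addr_ge0 ?sqr_ge0.
apply: norm_cvg0.
apply: (@squeeze_cvgr _ _ _ _ (cst 0) (fun n => 2 * c * harmonic n)).
- apply: nearW => n; rewrite normr_ge0/= /levy_kernel (negbTE t0) -/c.
  have n1 : 1 <= n.+1%:R :> R by rewrite ler1n.
  have n2 : 0 < n.+1%:R :> R by exact: lt_le_trans n1.
  rewrite normrM normfV [`|_ ^+ 2|]ger0_norm ?sqr_ge0// [`|(_ - 1) * _|]normrM (ger0_norm c0).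
  apply: ler_pM => //.
  + by rewrite mulr_ge0.
  + apply: ler_wpM2r => //; rewrite distrC ger0_norm ?subr_ge0 ?cos_le1//.
    by have := cos_geN1 (t * n.+1%:R); lra.
  + by rewrite lef_pV2 ?posrE ?exprn_gt0// expr2 ler_peMr// ltW.
- exact: cvg_cst.
- rewrite -(mulr0 (2 * c)); apply: cvgM; first exact: cvg_cst.
  exact: cvg_harmonic.
Qed.

Section Levy.
Variable G : finmeas R.
Hypothesis GE : forall xi, \int[G]_t levy_kernel xi t = - (xi ^+ 2 / 2).

Lemma levy_mass0 : G [set 0] = 1%E.
Proof.
have n0 (n : nat) : (n.+1%:R : R) ^+ 2 != 0 by rewrite expf_neq0.
have n1 (n : nat) : 1 <= (n.+1%:R : R) ^+ 2 by rewrite exprn_ege1// ler1n.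
have [||||_] := @cvg_Rintegral_dominated _ _ _ G setT
  (fun n t => levy_kernel n.+1%:R t / n.+1%:R ^+ 2)
  (fun t => - 2^-1 * \1_[set (0 : R)] t) (cst (2^-1 + 2)) measurableT.
- by move=> n; apply: measurable_funM => //; exact: measurable_levy_kernel.
- exact: finite_measure_integrable_cst.
- move=> n t _; have n00 : 0 < (n.+1%:R : R) ^+ 2 by exact: lt_le_trans (n1 n).
  rewrite normrM normfV [`|_ ^+ 2|]gtr0_norm// ler_pdivrMr//.
  by apply: le_trans (levy_kernel_bound _ _) _; rewrite /cst; have := n1 n; lra.
- by move=> t _; exact: cvg_levy_kernel.
rewrite RintegralZl//; last exact: integrable_indic.
have -> : (fun n => \int[G]_t (levy_kernel n.+1%:R t / n.+1%:R ^+ 2)) = cst (- 2^-1).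
  apply/funext => n; under eq_Rintegral do rewrite mulrC.
  rewrite RintegralZl//; last exact: integrable_levy_kernel.
  by rewrite GE /=; field.
move=> /(cvg_unique _ (cvg_cst _)) E.
rewrite -[LHS]fineK ?fin_num_measure//; congr EFin.
have : - 2^-1 = - 2^-1 * \int[G]_t \1_[set 0] t :> R by apply: E.
rewrite /Rintegral integral_indic// setIT => H.
by apply: (@mulfI _ (- 2^-1)); rewrite ?mulr1 ?oppr_eq0//; exact: esym H.
Qed.

(** The atom already accounts for the whole integral and the kernel has constant sign, so off 0 it
    vanishes almost everywhere, simultaneously for all frequencies 1/(k+1). At a point t != 0 this
    fails once |t|/(k+1) < 1, because the cosine is then different from 1. *)
Lemma levy_mass_compl : G (~` [set 0]) = 0%E.
Proof.
have m0 : measurable ([set 0] : set (measurableTypeR R)) by [].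
have mC := measurableC m0.
have ker0 xi : {ae G, forall t, (~` [set 0]) t -> levy_kernel xi t = 0}.
  have iC := integrable_levy_kernel G xi mC.
  have int0 : \int[G]_(t in ~` [set 0]) levy_kernel xi t = 0.
    have := GE xi; rewrite -(setvU ([set 0] : set (measurableTypeR R))).
    rewrite Rintegral_setU//; last 2 first.
    - by rewrite setvU; exact: integrable_levy_kernel.
    - by rewrite disj_set2E setICl eqxx.
    rewrite (@eq_Rintegral _ _ _ G [set 0] (cst (- (xi ^+ 2 / 2)))); last first.
      by move=> t; rewrite inE /= => ->; rewrite /levy_kernel eqxx.
    by rewrite Rintegral_cst// [X in fine X]levy_mass0 mulr1; lra.
  have := (ae_eq_integral_abs G mC (measurable_int _ iC)).1.
  move=> H; have {H} : ae_eq G (~` [set 0]) (EFin \o levy_kernel xi) (cst 0%E).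
    apply: H; transitivity (\int[G]_(t in ~` [set (0 : R)%R]) (-1 * levy_kernel xi t)%:E)%E.
      apply: eq_integral => t _ /=.
      by rewrite ler0_norm ?levy_kernel_le0// mulN1r.
    rewrite -[LHS]fineK; last first.
      by apply: integrable_fin_num => //; exact: (integrableZl mC (-1) iC).
    by congr EFin; rewrite -/(Rintegral _ _ _) RintegralZl// int0 mulr0.
  by apply: filterS => t H t0; have [] := H t0.
have : {ae G, forall t, forall k : nat, (~` [set 0]) t -> levy_kernel k.+1%:R^-1 t = 0}.
  by apply: ae_foralln => k; exact: ker0.
move=> [A [mA A0 sub]]; apply/eqP; rewrite eq_le measure_ge0 andbT -A0.
apply: (le_measure G); rewrite ?inE// => t t0; apply: sub => /= H.
have tn0 : t != 0 by apply/eqP.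
have := H (Num.bound `|t|) t0; rewrite /levy_kernel (negbTE tn0).
move=> /eqP; rewrite !mulf_eq0 invr_eq0 sqrf_eq0 (negbTE tn0) orbF => /orP[].
  rewrite subr_eq0 => /eqP/cos_eq1_small; rewrite normrM normfV.
  have k0 : 0 < (Num.bound `|t|).+1%:R :> R by [].
  rewrite (gtr0_norm k0) ltr_pdivrMr// mul1r => H0.
  have : t * (Num.bound `|t|).+1%:R^-1 = 0.
    apply: H0; apply: lt_le_trans (archi_boundP (normr_ge0 _)) _.
    by rewrite ler_nat.
  by move/eqP; rewrite mulf_eq0 (negbTE tn0) invr_eq0 pnatr_eq0.
by rewrite gt_eqF// ltr_pwDl// sqr_ge0.
Qed.

Lemma Rintegral_levy (f : R -> R) : measurable_fun setT f -> \int[G]_t f t = f 0.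
Proof.
move=> mf; have m0 : measurable ([set 0] : set (measurableTypeR R)) by [].
have mC := measurableC m0.
have GT : G setT = 1%E.
  rewrite -(setvU ([set 0] : set (measurableTypeR R))) measureU//.
  - by rewrite [X in (X + _)%E]levy_mass_compl add0e; exact: levy_mass0.
  - exact: setICl.
transitivity (\int[G]_t (cst (f 0) t)); last first.
  by rewrite Rintegral_cst// [X in fine X]GT mulr1.
rewrite /Rintegral; congr fine; apply: ae_eq_integral => //.
- exact/measurable_EFinP.
- exact/measurable_EFinP.
- exists (~` [set 0]); split=> //; first exact: levy_mass_compl.
  by move=> t /=; apply: contra_not => -> _.
Qed.

End Levy.

Lemma Rintegral_levy_gaussian G (f : R -> R) : is_levy (normal_prob 0 1) G ->
  measurable_fun setT f -> \int[G]_t f t = f 0.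
Proof.
move=> [_ GL] mf; apply: Rintegral_levy => // xi.
have := GL xi; rewrite /cintegral => -[+ _].
rewrite normal_prob_cos => /expR_inj ->; ring.
Qed.
End LevyDirac.

(** * A trigonometric integral and its substitution *)

Section ArcIntegral.
Context {R : realType}.
Implicit Types (q s x t : R).

(** An antiderivative of sin^2 t / |1 + q e^(it)|^2. The arctangent is the argument of 1 + q e^(it);
    its coefficient vanishes for q = 1, precisely the case where the quotient is singular at t =
    pi. *)
Definition psi q t : R := t / 2 - sin t / (2 * q) +
  (1 - q ^+ 2) / (2 * q ^+ 2) * atan (q * sin t / (1 + q * cos t)).

Lemma is_derive_psi q t : 0 < q -> q <= 1 -> -1 < cos t ->
  is_derive t 1 (psi q) (sin t ^+ 2 / (1 + q ^+ 2 + 2 * q * cos t)).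
Proof.
move=> q0 q1 c1.
have qc : - q < q * cos t by rewrite -mulrN1 ltr_pM2l.
have E0 : 0 < 1 + q * cos t by lra.
have D0 : 0 < 1 + q ^+ 2 + 2 * q * cos t.
  apply: (@le_lt_trans _ _ ((1 - q) ^+ 2)); first exact: sqr_ge0.
  by rewrite (_ : (1 - q) ^+ 2 = 1 + q ^+ 2 + 2 * - q); [lra|ring].
have En : 1 + q * cos t != 0 by rewrite gt_eqF.
have Dn : 1 + q ^+ 2 + 2 * q * cos t != 0 by rewrite gt_eqF.
have qn : q != 0 by rewrite gt_eqF.
have dV : is_derive t 1 (fun t => (1 + q * cos t)^-1)
    (- (1 + q * cos t) ^- 2 *: (- (q * sin t))).
  by apply: is_deriveV => //; apply: is_derive_eq; rewrite /GRing.scale/=; ring.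
have S2 : sin t ^+ 2 = 1 - cos t ^+ 2 by rewrite sin2cos2.
have AE : (1 + (q * sin t / (1 + q * cos t)) ^+ 2)^-1 =
    (1 + q * cos t) ^+ 2 / (1 + q ^+ 2 + 2 * q * cos t).
  have -> : 1 + (q * sin t / (1 + q * cos t)) ^+ 2 =
      (1 + q ^+ 2 + 2 * q * cos t) / (1 + q * cos t) ^+ 2.
    by rewrite expr_div_n exprMn S2; field.
  by rewrite invf_div.
rewrite /psi; apply: is_derive_eq; rewrite /GRing.scale/= AE.
set S := sin t in S2 *; set C := cos t in En Dn S2 *.
transitivity (2^-1 - C / (2 * q) + (1 - q ^+ 2) / (2 * q ^+ 2) *
   ((q * C * (1 + q * C) + q ^+ 2 * S ^+ 2) / (1 + q ^+ 2 + 2 * q * C))).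
  by field; rewrite En Dn qn.
by rewrite S2; field; rewrite Dn qn.
Qed.

Lemma continuous_psi q : 0 < q -> q <= 1 -> continuous (psi q).
Proof.
move=> q0; rewrite le_eqVlt => /orP[/eqP ->|q1] t.
  have -> : psi 1 = (fun t => t / 2 - sin t / 2).
    by apply/funext => y; rewrite /psi expr1n subrr mul0r mul0r addr0 mulr1.
  apply: cvgB; apply: cvgM; [exact: cvg_id|exact: cvg_cst|exact: continuous_sin|].
  exact: cvg_cst.
have E0 y : 0 < 1 + q * cos y.
  have : q * -1 <= q * cos y by rewrite ler_pM2l// cos_geN1.
  by lra.
apply: cvgD.
  apply: cvgB; apply: cvgM; [exact: cvg_id|exact: cvg_cst|exact: continuous_sin|].
  exact: cvg_cst.
apply: cvgM; first exact: cvg_cst.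
apply: (@continuous_comp _ _ _ (fun t => q * sin t / (1 + q * cos t)) atan);
  last exact: continuous_atan.
apply: cvgM; first by apply: cvgM; [exact: cvg_cst|exact: continuous_sin].
apply: cvgV; first by rewrite gt_eqF.
apply: cvgD; first exact: cvg_cst.
by apply: cvgM; [exact: cvg_cst|exact: continuous_cos].
Qed.

Lemma continuous_acos_segment : {within `[-1, 1], continuous (@acos R)}.
Proof.
rewrite -cospi -cos0; apply: segment_can_ge_continuous; first exact: pi_ge0.
- by apply: continuous_subspaceT; exact: continuous_cos.
- exact: cosK.
Qed.

(** The value of cos t when x is the modulus of 1 + s e^(it). *)
Definition arc_cos s x : R := (x ^+ 2 - 1 - s ^+ 2) / (2 * s).

Lemma arc_cos_oo s x : 0 < s -> s <= 1 -> 1 - s < x -> x < 1 + s ->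
  -1 < arc_cos s x < 1.
Proof.
move=> s0 s1 sx xs; have s20 : 0 < 2 * s by lra.
rewrite /arc_cos ltr_pdivlMr// ltr_pdivrMr//; apply/andP; split.
  have : (1 - s) ^+ 2 < x ^+ 2 by rewrite ltr_pXn2r// ?nnegrE; lra.
  by rewrite sqrrB; nra.
have : x ^+ 2 < (1 + s) ^+ 2 by rewrite ltr_pXn2r// ?nnegrE; lra.
by rewrite sqrrD; nra.
Qed.

Lemma arc_cos_cc s x : 0 < s -> s <= 1 -> 1 - s <= x -> x <= 1 + s ->
  -1 <= arc_cos s x <= 1.
Proof.
move=> s0 s1 sx xs; have s20 : 0 < 2 * s by lra.
rewrite /arc_cos ler_pdivlMr// ler_pdivrMr//; apply/andP; split.
  have : (1 - s) ^+ 2 <= x ^+ 2 by rewrite lerXn2r// ?nnegrE; lra.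
  by rewrite sqrrB; nra.
have : x ^+ 2 <= (1 + s) ^+ 2 by rewrite lerXn2r// ?nnegrE; lra.
by rewrite sqrrD; nra.
Qed.

Lemma continuous_arc_cos s : continuous (arc_cos s).
Proof.
move=> x; apply: cvgM; last exact: cvg_cst.
by apply: cvgB; [apply: cvgB; [exact: exprn_continuous|exact: cvg_cst]|exact: cvg_cst].
Qed.

Lemma continuous_acos_arc_cos s : 0 < s -> s <= 1 ->
  {within `[1 - s, 1 + s], continuous (@acos R \o arc_cos s)}.
Proof.
move=> s0 s1; apply/subspace_continuousP => x /=; rewrite in_itv/= => /andP[sx xs].
apply: (@cvg_comp _ _ _ (arc_cos s) acos _
  (within `[-1, 1]%classic (nbhs (arc_cos s x)))); last first.
  have /subspace_continuousP Hc := continuous_acos_segment; apply: Hc.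
  by rewrite /= in_itv/=; exact: arc_cos_cc.
move=> A; rewrite /within/= => HA.
have := @continuous_arc_cos s x _ HA; rewrite /nbhs/=.
rewrite !near_simpl; apply: filterS => y H /=; rewrite in_itv/= => /andP[sy ys].
by apply: H; rewrite /= in_itv/=; exact: arc_cos_cc.
Qed.

(* The substitution x^2 = 1 + s^2 + 2 s cos t turns the integral into that of
   sin^2 t / (1 + q^2 + 2 q cos t) over [0, pi]. *)
Lemma arc_integral s q (k : R -> R) : 0 < s -> s <= 1 -> 0 < q -> q <= 1 ->
  {within `[1 - s, 1 + s], continuous k} ->
  (forall x, 1 - s < x -> x < 1 + s ->
     k x = Num.sqrt (1 - arc_cos s x ^+ 2) * x /
           (s * (1 + q ^+ 2 + 2 * q * arc_cos s x))) ->
  \int[lebesgue_measure]_(x in `[1 - s, 1 + s]) k x = pi / 2.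
Proof.
move=> s0 s1 q0 q1 ck kE.
have ab : 1 - s < 1 + s by lra.
(* The sign comes from [acos] being decreasing: x = 1 - s and x = 1 + s correspond to t = pi and t =
   0. The derivative is taken inside the segment only, as [acos] is not differentiable at -1 and
   1. *)
pose F x := - psi q (acos (arc_cos s x)).
have dF x : 1 - s < x -> x < 1 + s -> is_derive x 1 F (k x).
  move=> sx xs; have cx := arc_cos_oo s0 s1 sx xs.
  have /andP[c1 c2] := cx.
  have cx' : -1 <= arc_cos s x <= 1 by rewrite !ltW.
  have c2p : 0 < 1 - arc_cos s x ^+ 2.
    have -> : 1 - arc_cos s x ^+ 2 = (1 - arc_cos s x) * (1 + arc_cos s x) by ring.
    by apply: mulr_gt0; lra.
  have dc : is_derive x 1 (arc_cos s) (x / s).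
    by rewrite /arc_cos; apply: is_derive_eq; rewrite /GRing.scale/=; field; rewrite gt_eqF.
  have da := is_derive1_acos cx.
  have ca : cos (acos (arc_cos s x)) = arc_cos s x by rewrite acosK// in_itv.
  have dp : is_derive (acos (arc_cos s x)) 1 (psi q)
      (sin (acos (arc_cos s x)) ^+ 2 / (1 + q ^+ 2 + 2 * q * cos (acos (arc_cos s x)))).
    by apply: is_derive_psi => //; rewrite ca.
  rewrite /F; apply: is_derive_eq.
  rewrite /GRing.scale/= kE// ca sin_acos// sqr_sqrtr; last exact: ltW.
  have D0 : 0 < 1 + q ^+ 2 + 2 * q * arc_cos s x.
    apply: (@le_lt_trans _ _ ((1 - q) ^+ 2)); first exact: sqr_ge0.
    rewrite (_ : (1 - q) ^+ 2 = 1 + q ^+ 2 + 2 * q * -1); last by ring.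
    by rewrite ltrD2l ltr_pM2l// mulr_gt0.
  have w0 : 0 < Num.sqrt (1 - arc_cos s x ^+ 2) by rewrite sqrtr_gt0.
  have -> : 1 - arc_cos s x ^+ 2 = Num.sqrt (1 - arc_cos s x ^+ 2) ^+ 2.
    by rewrite sqr_sqrtr// ltW.
  rewrite sqrtr_sqr (gtr0_norm w0).
  by field; rewrite (gt_eqF D0) (gt_eqF s0) (gt_eqF w0).
have cF : {within `[1 - s, 1 + s], continuous F}.
  move=> x; apply: (@continuous_comp (subspace `[1 - s, 1 + s]) R R
      (@acos R \o arc_cos s) (fun t => - psi q t)).
    exact: continuous_acos_arc_cos.
  by apply: cvgN; exact: continuous_psi.
have -> : pi / 2 = F (1 + s) - F (1 - s).
  have -> : F (1 + s) = 0.
    rewrite /F (_ : arc_cos _ _ = 1); last by rewrite /arc_cos; field; rewrite gt_eqF.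
    by rewrite acos1 /psi sin0 !(mulr0,mul0r) atan0 mulr0 subr0 addr0 oppr0.
  have -> : F (1 - s) = - (pi / 2).
    rewrite /F (_ : arc_cos _ _ = -1); last by rewrite /arc_cos; field; rewrite gt_eqF.
    by rewrite acosN1 /psi sinpi !(mulr0,mul0r) atan0 mulr0 subr0 addr0.
  by rewrite opprK add0r.
have /continuous_within_itvP[//|_ Fa Fb] := cF.
rewrite /Rintegral (@continuous_FTC2 _ k F)//.
- split; [|exact: Fa|exact: Fb].
  by move=> x; rewrite in_itv/= => /andP[sx xs]; case: (dF x sx xs).
- move=> x; rewrite in_itv/= => /andP[sx xs]; rewrite derive1E.
  have dFx := dF x sx xs; exact: derive_val.
Qed.
End ArcIntegral.

(** * The density for a positive ratio *)

Section RectDensity.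
Context {R : realType} (lam : R).
Hypotheses (lam0 : 0 < lam) (lam1 : lam <= 1).
Implicit Types (x r u : R).
Notation mu := (@lebesgue_measure R).

(* Redefined at [x = 0] when [lam = 1], where the quotient is the junk value 0,
   so as to be continuous. *)
Definition rect_density x : R :=
  if lam == 1 then Num.sqrt (4 - x ^+ 2) / (2 * pi)
  else Num.sqrt (4 * lam - (x ^+ 2 - 1 - lam) ^+ 2) / (2 * pi * lam * `|x|).

Let s := Num.sqrt lam.

Let s2 : s ^+ 2 = lam. Proof. by rewrite sqr_sqrtr// ltW. Qed.

Let s0 : 0 < s. Proof. by rewrite sqrtr_gt0. Qed.

Let s1 : s <= 1. Proof. by rewrite -sqrtr1 ler_sqrt. Qed.

Let pi0 : 0 < pi :> R. Proof. exact: pi_gt0. Qed.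

Lemma rect_density_factor x : 4 * lam - (x ^+ 2 - 1 - lam) ^+ 2 =
  ((1 + s) ^+ 2 - x ^+ 2) * (x ^+ 2 - (1 - s) ^+ 2).
Proof. by rewrite -s2; ring. Qed.

Lemma rect_densityE x : x != 0 -> rect_density x =
  Num.sqrt (4 * lam - (x ^+ 2 - 1 - lam) ^+ 2) / (2 * pi * lam * `|x|).
Proof.
move=> x0; rewrite /rect_density; case: ifP => // /eqP l1.
have -> : 4 * lam - (x ^+ 2 - 1 - lam) ^+ 2 = x ^+ 2 * (4 - x ^+ 2).
  by rewrite l1; ring.
rewrite sqrtrM ?sqr_ge0// sqrtr_sqr l1.
move: (@pi R) pi0 => p p0; field.
by rewrite normr_eq0 x0 gt_eqF.
Qed.

Lemma rect_density_ge0 x : 0 <= rect_density x.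
Proof.
have p0 : 0 <= 2 * pi :> R by rewrite mulr_ge0// ltW.
rewrite /rect_density; case: ifP => _; rewrite divr_ge0 ?sqrtr_ge0//.
by rewrite !mulr_ge0// ltW.
Qed.

Lemma rect_density_even x : rect_density (- x) = rect_density x.
Proof. by rewrite /rect_density sqrrN normrN. Qed.

Lemma rect_density_out x : `|x| < 1 - s \/ 1 + s < `|x| -> rect_density x = 0.
Proof.
have s_gt0 := s0; have s_le1 := s1.
have x2 : x ^+ 2 = `|x| ^+ 2 by rewrite real_normK ?num_real.
have [->|x0] := eqVneq x 0.
  rewrite normr0 => -[sl|sl]; last by lra.
  rewrite /rect_density ifF; first by rewrite normr0 mulr0 invr0 mulr0.
  by apply/eqP => l1; have := s2; rewrite l1 expr2; have := s0; nra.
move=> H; rewrite rect_densityE// rect_density_factor ler0_sqrtr ?mul0r//.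
have n0 := normr_ge0 x; rewrite x2; case: H => H.
  have h1 : `|x| ^+ 2 <= (1 - s) ^+ 2 by rewrite lerXn2r ?nnegrE; lra.
  have h2 : (1 - s) ^+ 2 <= (1 + s) ^+ 2 by rewrite lerXn2r ?nnegrE; lra.
  by apply: mulr_ge0_le0; lra.
have h1 : (1 + s) ^+ 2 <= `|x| ^+ 2 by rewrite lerXn2r ?nnegrE; lra.
have h2 : (1 - s) ^+ 2 <= (1 + s) ^+ 2 by rewrite lerXn2r ?nnegrE; lra.
by apply: mulr_le0_ge0; lra.
Qed.

(** For lam < 1 the density vanishes on the gap |x| < 1 - s, so the division by |x| does no harm at
    0. *)
Lemma continuous_rect_density : continuous rect_density.
Proof.
have s_le1 := s1.
move=> x; have [l1|l1] := eqVneq lam 1.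
  have -> : rect_density = fun x => Num.sqrt (4 - x ^+ 2) / (2 * pi).
    by apply/funext => y; rewrite /rect_density l1 eqxx.
  apply: cvgM; last exact: cvg_cst.
  apply: (@continuous_comp _ _ _ (fun x : R => 4 - x ^+ 2) Num.sqrt);
    last exact: sqrt_continuous.
  by apply: cvgB; [exact: cvg_cst|exact: exprn_continuous].
have [->|x0] := eqVneq x 0.
  have sl : 0 < 1 - s.
    rewrite subr_gt0 lt_neqAle s_le1 andbT; apply: contra l1 => /eqP sE.
    by rewrite -s2 sE expr1n.
  rewrite /continuous_at [X in _ --> X]rect_density_out; last by left; rewrite normr0.
  apply: cvg_near_cst; near=> y; apply: rect_density_out; left.
  near: y; exists (1 - s) => //= z /=.
  by rewrite sub0r normrN.
have -> : rect_density = fun x =>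
    Num.sqrt (4 * lam - (x ^+ 2 - 1 - lam) ^+ 2) / (2 * pi * lam * `|x|).
  by apply/funext => y; rewrite /rect_density (negbTE l1).
apply: cvgM.
  apply: (@continuous_comp _ _ _ (fun x : R => 4 * lam - (x ^+ 2 - 1 - lam) ^+ 2) Num.sqrt);
    last exact: sqrt_continuous.
  apply: cvgB; first exact: cvg_cst.
  apply: (@continuous_comp _ _ _ (fun x : R => x ^+ 2 - 1 - lam) (fun y => y ^+ 2));
    last exact: exprn_continuous.
  apply: cvgB; last exact: cvg_cst.
  by apply: cvgB; [exact: exprn_continuous|exact: cvg_cst].
apply: cvgV; first by rewrite gt_eqF// !mulr_gt0 ?normr_gt0 ?pi0 ?lam0.
by apply: cvgM; [exact: cvg_cst|exact: norm_continuous].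
Unshelve. all: by end_near. Qed.

Lemma rect_density_arc x : 1 - s < x -> x < 1 + s ->
  rect_density x = Num.sqrt (1 - arc_cos s x ^+ 2) / (pi * s * x).
Proof.
have s_gt0 := s0; have s_le1 := s1.
move=> sx xs; have x0 : 0 < x by lra.
rewrite rect_densityE ?gt_eqF// (gtr0_norm x0).
have -> : 4 * lam - (x ^+ 2 - 1 - lam) ^+ 2 = (2 * s) ^+ 2 * (1 - arc_cos s x ^+ 2).
  by rewrite /arc_cos -s2; field; rewrite gt_eqF.
rewrite sqrtrM ?sqr_ge0// sqrtr_sqr gtr0_norm; last by rewrite mulr_gt0.
move: (@pi R) pi0 => p p0.
by rewrite -s2; field; rewrite (gt_eqF p0) (gt_eqF s0) (gt_eqF x0).
Qed.

Lemma integral_rect_density_half :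
  \int[mu]_(x in `[1 - s, 1 + s]) rect_density x = 2^-1.
Proof.
have s_gt0 := s0; have s_le1 := s1.
have H : \int[mu]_(x in `[1 - s, 1 + s]) (pi * rect_density x) = pi / 2.
  (* With q = s the denominator 1 + q^2 + 2 q cos t is x^2 itself. *)
  apply: (@arc_integral _ s s) => //.
    apply: continuous_subspaceT => x; apply: cvgM; first exact: cvg_cst.
    exact: continuous_rect_density.
  move=> x sx xs; have x0 : 0 < x by lra.
  have -> : 1 + s ^+ 2 + 2 * s * arc_cos s x = x ^+ 2.
    by rewrite /arc_cos; field; rewrite gt_eqF.
  rewrite rect_density_arc//; move: (@pi R) pi0 => p p0.
  by field; rewrite (gt_eqF p0) (gt_eqF s0) (gt_eqF x0).
rewrite RintegralZl// in H; last first.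
  apply: continuous_compact_integrable; first exact: segment_compact.
  by apply: continuous_subspaceT; exact: continuous_rect_density.
by apply: (mulfI (lt0r_neq0 pi0)).
Qed.

(** One writes 1/(1 + u x^2) = 1 - u x^2/(1 + u x^2), where the factor x^2 turns the 1/x of the
    density into the x required by [arc_integral]. The choice q = r s works because 1 + q^2 + 2 q
    cos t = (1 - r)(1 - lam r)(1 + u x^2). *)
Lemma integral_rect_density_transform_half r : 0 < r -> r < 1 ->
  \int[mu]_(x in `[1 - s, 1 + s])
    (rect_density x / (1 + rect_arg lam r * x ^+ 2)) = (1 - r) / 2.
Proof.
have s_gt0 := s0; have s_le1 := s1.
move=> r0 r1; set u := rect_arg lam r; have u0 : 0 < u by exact: rect_arg_gt0.
have cV : continuous (fun x : R => (1 + u * x ^+ 2)^-1).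
  move=> x; apply: cvgV; first by rewrite gt_eqF// denom_gt0// ltW.
  apply: cvgD; first exact: cvg_cst.
  by apply: cvgM; [exact: cvg_cst|exact: exprn_continuous].
pose k x := rect_density x * (u * x ^+ 2 * (1 + u * x ^+ 2)^-1).
have ck : continuous k.
  move=> x; apply: cvgM; first exact: continuous_rect_density.
  apply: cvgM; last exact: cV.
  by apply: cvgM; [exact: cvg_cst|exact: exprn_continuous].
have ik : mu.-integrable `[1 - s, 1 + s] (EFin \o k).
  apply: continuous_compact_integrable; first exact: segment_compact.
  exact: continuous_subspaceT.
have H : \int[mu]_(x in `[1 - s, 1 + s]) (pi / r * k x) = pi / 2.
  apply: (@arc_integral _ s (r * s)) => //.
  - by rewrite mulr_gt0.
  - by nra.
  - apply: continuous_subspaceT => x; apply: cvgM; first exact: cvg_cst.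
    exact: ck.
  move=> x sx xs; have x0 : 0 < x by lra.
  have lr : lam * r <= r by rewrite ger_pMl.
  have E0 : 0 < (1 - r) * (1 - lam * r) by apply: mulr_gt0; lra.
  have D0 : 0 < 1 + u * x ^+ 2 by apply: denom_gt0; exact: ltW.
  have -> : 1 + (r * s) ^+ 2 + 2 * (r * s) * arc_cos s x =
      (1 - r) * (1 - lam * r) * (1 + u * x ^+ 2).
    rewrite /u /rect_arg /arc_cos -s2; field.
    by rewrite s2 (gt_eqF s_gt0) !gt_eqF//; lra.
  rewrite /k rect_density_arc// {1}/u /rect_arg.
  have l3 : 0 < 1 - lam * r by lra.
  have r3 : 0 < 1 - r by lra.
  move: (@pi R) pi0 => p p0; field.
  by rewrite (gt_eqF D0) (gt_eqF l3) (gt_eqF r3) (gt_eqF s_gt0) (gt_eqF x0)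
    (gt_eqF p0) (gt_eqF r0).
rewrite RintegralZl// in H.
have kE : \int[mu]_(x in `[1 - s, 1 + s]) k x = r / 2.
  apply: (@mulfI _ (pi / r)); first by rewrite gt_eqF// divr_gt0.
  rewrite H; move: (@pi R) pi0 => p p0.
  by field; rewrite gt_eqF.
have -> : (1 - r) / 2 = \int[mu]_(x in `[1 - s, 1 + s]) rect_density x -
    \int[mu]_(x in `[1 - s, 1 + s]) k x.
  by rewrite kE integral_rect_density_half; field.
rewrite -RintegralB//; last first.
  apply: continuous_compact_integrable; first exact: segment_compact.
  by apply: continuous_subspaceT; exact: continuous_rect_density.
apply: eq_Rintegral => x _; rewrite /k; field.
by rewrite gt_eqF// denom_gt0// ltW.
Qed.

Lemma integral_even_rect_density (f : R -> R) : continuous f ->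
  (forall x, 0 <= f x) -> (forall x, f (- x) = f x) ->
  (\int[mu]_x (rect_density x * f x)%:E)%E =
  (2 * \int[mu]_(x in `[1 - s, 1 + s]) (rect_density x * f x))%:E.
Proof.
move=> cf f0 fN.
have cdf : continuous (fun x => rect_density x * f x).
  by move=> x; apply: cvgM; [exact: continuous_rect_density|exact: cf].
have idf : mu.-integrable `[1 - s, 1 + s] (EFin \o (fun x => rect_density x * f x)).
  apply: continuous_compact_integrable; first exact: segment_compact.
  exact: continuous_subspaceT.
rewrite ge0_symfun_integralT//.
- rewrite EFinM; congr (_ * _)%E; rewrite /Rintegral fineK; last exact: integrable_fin_num.
  rewrite [LHS]integral_mkcond [RHS]integral_mkcond; apply: eq_integral => x _.
  rewrite !patchE; have [xs|xs] := boolP (x \in (`[1 - s, 1 + s]%classic : set R)).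
    rewrite mem_set//=; move: xs; rewrite inE/= in_itv/= => /andP[sx _].
    by have s_le1 := s1; lra.
  case: ifP => //; rewrite inE/= => x0.
  rewrite rect_density_out ?mul0r// ger0_norm//.
  have [sx|sx] := ltP x (1 - s); first by left.
  right; rewrite ltNge; apply: contraNN xs => xs.
  by rewrite inE/= in_itv/= sx.
- by move=> x; rewrite mulr_ge0// rect_density_ge0.
- by move=> x; rewrite /= rect_density_even fN.
Qed.
End RectDensity.

(** * The explicit measures *)

Section ModelMeasures.
Context {R : realType}.
Implicit Types (f : R -> R) (lam r : R).

Lemma exists_prob_density f : measurable_fun setT f -> (forall x, 0 <= f x) ->
  (\int[lebesgue_measure]_x (f x)%:E = 1)%E ->
  exists m : prob R, has_density m f.
Proof.
move=> mf f0 f1; pose nu (A : set (measurableTypeR R)) : \bar R :=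
  (\int[lebesgue_measure]_(x in A) (f x)%:E)%E.
have nu0 : nu set0 = 0%E by rewrite /nu integral_set0.
have nu_ge0 A : (0 <= nu A)%E by apply: integral_ge0 => x _; rewrite lee_fin.
have nu_sigma : semi_sigma_additive nu.
  apply: semi_sigma_additive_nng_induced; [exact/measurable_EFinP|].
  by move=> x; rewrite lee_fin.
pose mm := isMeasure.Build _ _ _ nu nu0 nu_ge0 nu_sigma.
pose m : {measure set (measurableTypeR R) -> \bar R} := HB.pack nu mm.
pose pm := Measure_isProbability.Build _ _ R m f1.
pose p : prob R := HB.pack nu mm pm.
by exists p.
Qed.

Lemma symmetric_even_density (m : prob R) f : continuous f -> (forall x, 0 <= f x) ->
  (forall x, f (- x) = f x) -> has_density m f -> symmetric_measure m.
Proof.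
move=> cf f0 fN md A mA.
have mf : measurable_fun setT f by exact: continuous_measurable_fun.
have mN : measurable_fun setT (-%R : measurableTypeR R -> measurableTypeR R).
  exact: oppr_measurable.
have imE (B : set (measurableTypeR R)) : [set - x | x in B] = -%R @^-1` B.
  apply/seteqP; split => [x [y By <-]/=|x Bx]; first by rewrite opprK.
  by exists (- x) => //; rewrite opprK.
rewrite imE; apply/esym; move: A mA.
apply: (@eq_measure_rays _ m
  (pushforward m (-%R : measurableTypeR R -> measurableTypeR R))) => x.
- rewrite /pushforward/=.
  rewrite [X in _ = m X](_ : _ = `]-oo, - x[%classic); last first.
    by apply/seteqP; split => y /=; rewrite !in_itv/= andbT ltrNr.
  rewrite !md//.
  rewrite integral_itv_obnd_cbnd; last exact/measurable_EFinP/measurable_funTS.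
  rewrite integral_itv_bndo_bndc; last exact/measurable_EFinP/measurable_funTS.
  rewrite ge0_integration_by_substitutionNy//; last exact: continuous_subspaceT.
  by apply: eq_integral => y _ /=; rewrite fN.
- by apply: le_lt_trans (probability_le1 _ _) _; rewrite ?ltry.
Qed.

Lemma exists_rect_prob lam : 0 < lam -> lam <= 1 ->
  exists m : prob R, [/\ has_density m (rect_density lam), symmetric_measure m,
    m (~` `[- (1 + Num.sqrt lam), 1 + Num.sqrt lam]) = 0%E
  & forall r, 0 < r -> r < 1 -> moment_transform m 0 (rect_arg lam r) = 1 - r].
Proof.
move=> l0 l1; have cd := continuous_rect_density l0 l1.
have d0 := rect_density_ge0 l0.
have md : measurable_fun setT (rect_density lam) by exact: continuous_measurable_fun.
have [|m mE] := exists_prob_density md d0.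
  transitivity (\int[lebesgue_measure]_x (rect_density lam x * cst 1 x)%:E)%E.
    by apply: eq_integral => x _; rewrite mulr1.
  rewrite integral_even_rect_density//; last by move=> x; exact: cvg_cst.
  congr EFin; under eq_Rintegral do rewrite mulr1.
  by rewrite integral_rect_density_half// divff.
exists m; split=> //.
- by apply: symmetric_even_density mE => // x; exact: rect_density_even.
- rewrite mE; last exact: measurableC.
  apply: integral0_eq => x /=; rewrite in_itv/= -ler_norml => /negP xs.
  by rewrite rect_density_out//; right; rewrite ltNge.
- move=> r r0 r1; have u0 : 0 < rect_arg lam r by exact: rect_arg_gt0.
  rewrite /moment_transform (integral_has_density md mE)//; last first.
    exact: (@integrable_moment_transform _ m 0 _ (ltW u0) (integrable_moment0 m)).
  rewrite /Rintegral.
  transitivity (fine (\int[lebesgue_measure]_x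
      (rect_density lam x * (1 + rect_arg lam r * x ^+ 2)^-1)%:E)%E).
    by congr fine; apply: eq_integral => x _; rewrite expr0 mul1r mulrC.
  rewrite integral_even_rect_density//=.
  + by rewrite integral_rect_density_transform_half// mulrC divfK.
  + move=> x; apply: cvgV; first by rewrite gt_eqF// denom_gt0// ltW.
    apply: cvgD; first exact: cvg_cst.
    by apply: cvgM; [exact: cvg_cst|exact: exprn_continuous].
  + by move=> x; rewrite invr_ge0 ltW// denom_gt0// ltW.
  + by move=> x; rewrite sqrrN.
Qed.

(** At ratio 0 the argument is u = r/(1 - r), and x^2 = 1 on both atoms, so the transform is 1/(1 +
    u) = 1 - r. *)
Lemma exists_rademacher : exists m : prob R,
  [/\ forall A : set (measurableTypeR R), measurable A ->
        m A = ((2^-1)%:E * (dirac (1 : R)%R A + dirac (- 1 : R)%R A))%E,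
      symmetric_measure m, m (~` `[- 1, 1]) = 0%E
  & forall r, 0 < r -> r < 1 -> moment_transform m 0 (rect_arg 0 r) = 1 - r].
Proof.
pose d1 : {measure set (measurableTypeR R) -> \bar R} := dirac (1 : measurableTypeR R).
pose d2 : {measure set (measurableTypeR R) -> \bar R} := dirac (-1 : measurableTypeR R).
have h0 : 0 <= 2^-1 :> R by [].
pose m0 : {measure set (measurableTypeR R) -> \bar R} :=
  mscale (NngNum h0) (measure_add d1 d2).
have m0E A : m0 A = ((2^-1)%:E * (dirac (1 : R)%R A + dirac (- 1 : R)%R A))%E.
  by rewrite /m0 /mscale; congr (_ * _)%E; exact: measure_addE.
have mT : m0 setT = 1%E.
  by rewrite m0E !diracT -EFinD -EFinM mulVf.
pose pm := Measure_isProbability.Build _ _ R m0 mT.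
pose m : prob R := HB.pack (Measure.sort m0) pm.
have mE A : m A = ((2^-1)%:E * (dirac (1 : R)%R A + dirac (- 1 : R)%R A))%E.
  exact: m0E.
exists m; split.
- by move=> A _; exact: mE.
- move=> A mA; rewrite !mE; congr (_ * _)%E; rewrite addeC !diracE.
  have E (x : R) : (x \in [set - y | y in A]) = (- x \in A).
    apply/idP/idP; rewrite !inE; first by move=> [y Ay <-]; rewrite opprK.
    by move=> Ax; exists (- x) => //; rewrite opprK.
  by rewrite !E opprK.
- rewrite mE !diracE !memNset/= ?adde0 ?mule0//.
  + by apply; rewrite in_itv/=; apply/andP; split; lra.
  + by apply; rewrite in_itv/=; apply/andP; split; lra.
- move=> r r0 r1; have u0 : 0 < rect_arg 0 r by exact: rect_arg_gt0.
  have i0 := @integrable_moment_transform _ m 0 _ (ltW u0) (integrable_moment0 m).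
  pose g (x : measurableTypeR R) : R := x ^+ 0.*2 / (1 + rect_arg 0 r * x ^+ 2).
  have g_ge0 x : 0 <= g x.
    by rewrite /g divr_ge0 ?expr_double_ge0// ltW// denom_gt0// ltW.
  have mg : measurable_fun setT (EFin \o g).
    by apply/measurable_EFinP; apply: measurable_moment_transform; exact: ltW.
  rewrite /moment_transform /Rintegral.
  transitivity (fine (\int[m0]_x (g x)%:E)%E); first by [].
  rewrite ge0_integral_mscale//=; last by move=> x _; rewrite lee_fin.
  rewrite ge0_integral_measure_add//=; last by move=> x _; rewrite lee_fin.
  rewrite !integral_dirac// !diracT !mul1e -EFinD -EFinM /=.
  by rewrite /g /rect_arg sqrrN expr1n !expr0; field; lra.
Qed.
End ModelMeasures.

(** * Supports *)

Section Support.
Context {R : realType}.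
Implicit Types (f : R -> R) (c d lam x : R).
Notation mu := (@lebesgue_measure R).

(** A zero integral would make the density vanish almost everywhere on an interval of positive
    length. *)
Lemma density_itv_gt0 f c d : measurable_fun setT f -> c < d ->
  (forall x, c < x -> x < d -> 0 < f x) -> (0 < \int[mu]_(x in `]c, d[) (f x)%:E)%E.
Proof.
move=> mf cd f0; have mI : measurable (`]c, d[%classic : set R) by [].
have f_ge0 x : `]c, d[%classic x -> (0 <= (f x)%:E)%E.
  by rewrite /= in_itv/= lee_fin => /andP[cx xd]; rewrite ltW// f0.
rewrite lt_neqAle integral_ge0// andbT eq_sym; apply/eqP => int0.
have mfI : measurable_fun `]c, d[ (EFin \o f).
  by apply/measurable_EFinP; exact: measurable_funTS.
have abs0 : (\int[mu]_(x in `]c, d[) `|(EFin \o f) x| = 0)%E.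
  by rewrite -int0; apply: eq_integral => x; rewrite inE => /f_ge0 /gee0_abs.
have [/(_ abs0) [N [mN N0 sub]] _] := ae_eq_integral_abs mu mI mfI.
have : (mu `]c, d[%classic <= mu N)%E.
  apply: le_measure; rewrite ?inE// => x /= xI; apply: sub => /= H.
  move: (xI); rewrite in_itv/= => /andP[cx xd].
  by have [] := H xI; have := f0 x cx xd => /[swap] ->; rewrite ltxx.
rewrite [X in (_ <= X)%E]N0 lebesgue_measure_itv/= lte_fin cd -EFinB lee_fin.
by lra.
Qed.

(** Positivity is asked on some interval close to [x] rather than around it, since a density may
    vanish at the edges of its support. *)
Lemma msupport_closed_density (m : prob R) f (S : set R) : measurable_fun setT f ->
  (forall x, 0 <= f x) -> has_density m f -> closed S -> (forall x, ~ S x -> f x = 0) ->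
  (forall x e, S x -> 0 < e -> exists c d, [/\ c < d, x - e <= c, d <= x + e
    & forall y, c < y -> y < d -> 0 < f y]) ->
  msupport m = S.
Proof.
move=> mf f0 md cS fS HS; apply/seteqP; split => x.
- move=> H; apply: contrapT => Sx.
  have oC : open (~` S) by exact: closed_openC.
  have := H _ oC Sx; rewrite md; last exact: open_measurable.
  by rewrite integral0_eq ?ltxx// => y /fS ->.
- move=> Sx U oU Ux.
  have /nbhs_ballP[e /= e0 eU] : nbhs x U by exact: open_nbhs_nbhs.
  have [c [d [cd xc dx fpos]]] := HS x e Sx e0.
  have sub : `]c, d[%classic `<=` U.
    move=> y /=; rewrite in_itv/= => /andP[cy yd]; apply: eU.
    by rewrite /ball/= ltr_distl; apply/andP; split; lra.
  rewrite md; last exact: open_measurable.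
  apply: (lt_le_trans (density_itv_gt0 mf cd fpos)).
  apply: ge0_subset_integral => //; first exact: open_measurable.
    by apply/measurable_EFinP; exact: measurable_funTS.
  by move=> y _; rewrite lee_fin.
Qed.

Lemma rect_density_gt0 lam x : 0 < lam -> lam <= 1 ->
  1 - Num.sqrt lam < `|x| -> `|x| < 1 + Num.sqrt lam -> 0 < rect_density lam x.
Proof.
move=> l0 l1 sx xs.
have s0 : 0 < Num.sqrt lam by rewrite sqrtr_gt0.
have s1 : Num.sqrt lam <= 1 by rewrite -sqrtr1 ler_sqrt.
have -> : rect_density lam x = rect_density lam `|x|.
  by have [_|_] := ger0P x; rewrite ?rect_density_even.
have x0 : 0 < `|x| by lra.
rewrite rect_density_arc//; have /andP[c1 c2] := arc_cos_oo s0 s1 sx xs.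
apply: divr_gt0; last by rewrite !mulr_gt0// pi_gt0.
rewrite sqrtr_gt0.
have -> : 1 - arc_cos (Num.sqrt lam) `|x| ^+ 2 =
  (1 - arc_cos (Num.sqrt lam) `|x|) * (1 + arc_cos (Num.sqrt lam) `|x|) by ring.
by apply: mulr_gt0; lra.
Qed.

Lemma rect_support_in (s x : R) :
  (`[-1 - s, -1 + s] `|` `[1 - s, 1 + s]) x <->
  (-1 - s <= x /\ x <= -1 + s) \/ (1 - s <= x /\ x <= 1 + s).
Proof. by split => -[]; rewrite /= ?in_itv/= => /andP; tauto. Qed.

Lemma msupport_rect (m : prob R) lam : 0 < lam -> lam <= 1 ->
  has_density m (rect_density lam) ->
  msupport m = `[-1 - Num.sqrt lam, -1 + Num.sqrt lam] `|`
               `[1 - Num.sqrt lam, 1 + Num.sqrt lam].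
Proof.
move=> l0 l1 md; set s := Num.sqrt lam.
have s0 : 0 < s by rewrite sqrtr_gt0.
have s1 : s <= 1 by rewrite -sqrtr1 ler_sqrt.
apply: (msupport_closed_density _ _ md).
- by apply: continuous_measurable_fun; exact: continuous_rect_density.
- exact: rect_density_ge0.
- by apply: closedU; exact: itv_closed.
- move=> x /rect_support_in H; apply: rect_density_out => //.
  have [xs|xs] := ltP `|x| (1 - s); first by left.
  right; rewrite ltNge -/s; apply/negP => xs'; apply: H.
  have [x0|x0] := leP 0 x; [right|left].
    by rewrite ger0_norm// in xs xs' *.
  by rewrite ltr0_norm// in xs xs'; split; lra.
- move=> x e /rect_support_in H e0; case: H => -[h1 h2].
  + exists (Num.max (x - e) (-1 - s)), (Num.min (x + e) (-1 + s)).
    rewrite le_max lexx ge_min lexx lt_min !gt_max; split=> //.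
      by apply/andP; split; apply/andP; split; lra.
    move=> y; rewrite gt_max lt_min => /andP[_ y1] /andP[_ y2].
    have y0 : y < 0 by lra.
    by apply: rect_density_gt0 => //; rewrite ltr0_norm// -/s; lra.
  + exists (Num.max (x - e) (1 - s)), (Num.min (x + e) (1 + s)).
    rewrite le_max lexx ge_min lexx lt_min !gt_max; split=> //.
      by apply/andP; split; apply/andP; split; lra.
    move=> y; rewrite gt_max lt_min => /andP[_ y1] /andP[_ y2].
    have y0 : 0 < y by lra.
    by apply: rect_density_gt0 => //; rewrite gtr0_norm// -/s; lra.
Qed.

(** Gives the passage from [rect_density], redefined at 0, to the quotient of the theorem, as a
    single point is negligible. *)
Lemma has_density_off0 (m : prob R) f g : measurable_fun setT f ->
  has_density m f -> (forall x, x != 0 -> g x = f x) -> has_density m g.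
Proof.
move=> mf md gf A mA; rewrite md//.
have mg : measurable_fun setT g.
  have -> : g = fun x => if x == 0 then g 0 else f x.
    by apply/funext => x; have [->//|/gf] := eqVneq x 0.
  apply: measurable_fun_ifT => //.
  by apply: measurable_fun_eqr; [exact: measurable_id|exact: measurable_cst].
apply: ae_eq_integral => //.
- by apply/measurable_EFinP; exact: measurable_funTS.
- by apply/measurable_EFinP; exact: measurable_funTS.
- exists [set 0]; split=> //; first exact: lebesgue_measure_set1.
  move=> x /= H; apply: contrapT => /eqP x0; apply: H => _.
  by rewrite gf.
Qed.

Lemma msupport_rademacher (m : prob R) :
  (forall A : set (measurableTypeR R), measurable A ->
     m A = ((2^-1)%:E * (dirac (1 : R)%R A + dirac (- 1 : R)%R A))%E) ->
  msupport m = [set -1; 1].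
Proof.
move=> mE; apply/seteqP; split => x.
- move=> H; apply: contrapT => /= x1.
  have oC : open (~` [set -1; 1] : set R).
    by apply: closed_openC; apply: closedU; exact: closed_eq.
  have := H _ oC x1; rewrite mE; last exact: open_measurable.
  have nin (y : R) : [set -1; 1] y -> (y \in (~` [set -1; 1] : set R)) = false.
    by move=> Sy; apply: memNset => /(_ Sy).
  have [n1 n2] : [set -1; 1] (-1 : R) /\ [set -1; 1] (1 : R) by split; [left|right].
  by rewrite !diracE !nin//= adde0 mule0 ltxx.
- move=> xS U oU Ux; rewrite mE; last exact: open_measurable.
  rewrite mule_gt0// ?lte_fin ?invr_gt0//.
  case: xS => /= xE; rewrite xE in Ux; rewrite !indicE (mem_set Ux).
    by rewrite ltr_pwDr// ler0n.
  by rewrite ltr_pwDl// ler0n.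
Qed.
End Support.

(** * The rectangular Gaussian: transform, moments and cumulants *)

Section RectGaussian.
Context {R : realType}.
Implicit Types (lam r : R) (nu : prob R).

Lemma rect_levy_gaussian_id (G : finmeas R) r :
  is_levy (normal_prob 0 1) G -> 0 < r ->
  - r%:C%C * cintegral G (fun t => (1 + t ^+ 2)%:C%C / (1 - (- r%:C%C) * (t ^+ 2)%:C%C)) =
  - r%:C%C.
Proof.
move=> GL r0; have fE (t : R) : (1 + t ^+ 2)%:C%C / (1 - (- r%:C%C) * (t ^+ 2)%:C%C) =
    ((1 + t ^+ 2) / (1 + r * t ^+ 2))%:C%C.
  have -> : 1 - (- r%:C%C) * (t ^+ 2)%:C%C = (1 + r * t ^+ 2)%:C%C.
    by apply/eqP; rewrite eq_complex /=; apply/andP; split; apply/eqP; ring.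
  by rewrite -fmorph_div.
have -> : (fun t : R => (1 + t ^+ 2)%:C%C / (1 - (- r%:C%C) * (t ^+ 2)%:C%C)) =
    (fun t => ((1 + t ^+ 2) / (1 + r * t ^+ 2))%:C%C).
  by apply/funext => t; rewrite fE.
rewrite /cintegral /= (Rintegral_levy_gaussian GL); last first.
  apply: continuous_measurable_fun => t; apply: cvgM.
    by apply: cvgD; [exact: cvg_cst|exact: exprn_continuous].
  apply: cvgV; first by rewrite gt_eqF// denom_gt0// ltW.
  apply: cvgD; first exact: cvg_cst.
  by apply: cvgM; [exact: cvg_cst|exact: exprn_continuous].
rewrite (Rintegral_levy_gaussian GL); last exact: measurable_cst.
by rewrite expr0n/= mulr0 !addr0 divr1 mulr1.
Qed.

Lemma rect_gaussian_transform lam nu : 0 <= lam -> lam <= 1 -> is_rect_gaussian lam nu ->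
  symmetric_measure nu /\ exists2 e, 0 < e & forall r, 0 < r -> r < e ->
    r < 1 /\ moment_transform nu 0 (rect_arg lam r) = 1 - r.
Proof.
move=> l0 l1 [_ [snu _] [G GL [_ RT]]]; split=> //.
apply: (Rtransform_id_moment_transform l0 l1 snu RT) => r r0.
exact: rect_levy_gaussian_id.
Qed.

Lemma rect_gaussian_unique lam nu (m : prob R) (K : R) : 0 <= lam -> lam <= 1 ->
  is_rect_gaussian lam nu -> 0 <= K -> symmetric_measure m ->
  m (~` `[- K, K]) = 0%E ->
  (forall r, 0 < r -> r < 1 -> moment_transform m 0 (rect_arg lam r) = 1 - r) ->
  forall A : set (measurableTypeR R), measurable A -> nu A = m A.
Proof.
move=> l0 l1 gnu K0 sm mK mE.
have [snu [e e0 He]] := rect_gaussian_transform l0 l1 gnu.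
have [u_ [u0 ucvg uE]] := rect_arg_sequence l1 e0 He.
have [|v_ [v0 vcvg vE]] := @rect_arg_sequence _ lam (moment_transform m 0) 1 l1 ltr01.
  by move=> r r0 r1; split=> //; exact: mE.
exact: (transform_unique K0 sm snu mK v0 vcvg u0 ucvg vE uE).
Qed.

Lemma rect_gaussian_moments lam nu : 0 <= lam -> lam <= 1 -> is_rect_gaussian lam nu ->
  (forall n, nu.-integrable setT (fun x : measurableTypeR R => (x ^+ n)%:E)) /\
  rect_recursion lam (fun n => moment nu n.*2).
Proof.
move=> l0 l1 gnu; have [snu [e e0 He]] := rect_gaussian_transform l0 l1 gnu.
have [u_ [u0 ucvg uE]] := rect_arg_sequence l1 e0 He.
split; last exact: transform_rect_recursion u0 ucvg uE.
move=> n; have i2 := transform_moments_integrable u0 ucvg uE n.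
(* The bound |x^n| <= 1 + x^(2n) covers the odd orders as well. *)
apply: (@le_integrable _ _ _ nu setT measurableT _ (fun x => 1%E + (x ^+ n.*2)%:E)%E).
- by apply/measurable_EFinP; exact: exprn_measurable.
- move=> x _ /=; rewrite lee_fin [leRHS]ger0_norm; last first.
    by rewrite addr_ge0// expr_double_ge0.
  rewrite -muln2 exprM -(real_normK (num_real (x ^+ n))).
  by have := sqr_ge0 (`|x ^+ n| - 1); rewrite sqrrB expr1n mulr1;
     have := normr_ge0 (x ^+ n); lra.
- apply: integrableD => //; exact: (finite_measure_integrable_cst nu 1 measurableT).
Qed.

Lemma rect_gaussian_cumulants lam nu (c : nat -> R) :
  0 <= lam -> lam <= 1 -> is_rect_gaussian lam nu ->
  is_free_cumulants lam nu c <->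
  (forall n, (0 < n)%N -> c n.*2 = (n == 1%N)%:R).
Proof.
move=> l0 l1 gnu; have [int rec] := rect_gaussian_moments l0 l1 gnu.
split=> [[_ mc]|cE]; last first.
  split=> // n _; rewrite -[RHS]/(cumulant_sum lam c n).
  by rewrite (cumulant_sum_min_weight rec).
(* The sequence [d] satisfies the same moment-cumulant relations, and triangularity forces [c] to
   agree with it at even orders. *)
move=> n n0; pose d (k : nat) : R := (k == 2)%:R.
have dE k : (0 < k)%N -> d k.*2 = (k == 1%N)%:R.
  by move=> _; congr (_%:R); apply/eqP/eqP; lia.
rewrite -dE//; apply: (@cumulant_sum_inj _ lam) => // k k0.
by rewrite (cumulant_sum_min_weight rec _ dE) -/(moment _ _) mc.
Qed.
End RectGaussian.

Theorem theorem4p3 (R : realType) (lam : R) (nu : probability (measurableTypeR R) R) :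
  0 <= lam -> lam <= 1 -> is_rect_gaussian lam nu ->
  [/\ forall c : nat -> R, is_free_cumulants lam nu c <->
        (forall n, (0 < n)%N -> c n.*2 = (n == 1%N)%:R),
      lam = 0 -> forall A : set (measurableTypeR R), measurable A ->
        nu A = ((2^-1)%:E * (dirac (1 : R)%R A + dirac (- 1 : R)%R A))%E,
      0 < lam -> has_density nu (fun x : R =>
        Num.sqrt (4 * lam - (x ^+ 2 - 1 - lam) ^+ 2) / (2 * pi * lam * `|x|) *
        \1_(`[(1 - Num.sqrt lam) ^+ 2, (1 + Num.sqrt lam) ^+ 2]) (x ^+ 2))
    & msupport nu = `[-1 - Num.sqrt lam, -1 + Num.sqrt lam] `|`
                    `[1 - Num.sqrt lam, 1 + Num.sqrt lam] ].
Proof.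
move=> l0 l1 gnu.
have rademacher : lam = 0 -> forall A : set (measurableTypeR R), measurable A ->
    nu A = ((2^-1)%:E * (dirac (1 : R)%R A + dirac (- 1 : R)%R A))%E.
  move=> lE A mA; have [m [mE sm mK mT]] := @exists_rademacher R.
  rewrite -mE//; apply: (rect_gaussian_unique l0 l1 gnu ler01) => //.
  by rewrite lE.
have density : 0 < lam -> has_density nu (rect_density lam).
  move=> lp; have [m [md sm mK mT]] := exists_rect_prob lp l1.
  move=> A mA; rewrite -md//.
  by apply: (rect_gaussian_unique l0 l1 gnu _ sm mK mT) => //; rewrite addr_ge0.
split=> //.
- by move=> c; exact: rect_gaussian_cumulants.
- move=> lp; apply: (has_density_off0 _ (density lp)).
    by apply: continuous_measurable_fun; exact: continuous_rect_density.
  move=> x x0; rewrite -rect_densityE//; rewrite indicE.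
  (* Where the indicator is 0 the radicand is negative, and the real square root of a negative
     number is 0 by convention. *)
  case: (boolP (_ \in _)) => [_|xout]; first by rewrite mulr1.
  rewrite mulr0 rect_density_out//; have n0 := normr_ge0 x.
  have s0 : 0 <= Num.sqrt lam by [].
  have s1 : Num.sqrt lam <= 1 by rewrite -sqrtr1 ler_sqrt.
  have [xs|xs] := ltP `|x| (1 - Num.sqrt lam); first by left.
  right; rewrite ltNge; apply: contra xout => xs'.
  rewrite inE/= in_itv/= -(real_normK (num_real x)).
  by apply/andP; split; rewrite lerXn2r ?nnegrE//; lra.
- move: l0; rewrite le_eqVlt => /orP[/eqP lE|lp]; last first.
    by apply: msupport_rect => //; exact: density.
  (* For lam = 0 both intervals shrink to single points. *)
  rewrite (msupport_rademacher (rademacher (esym lE))) -lE sqrtr0 !subr0 !addr0.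
  by rewrite !set_itv1.
Qed.
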